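(* Let $M$ be a connected topological manifold of dimension at least $2$ with an effective action of a finite group $G$, let $n\ge 2$, and let ${\bf x}\in F_G(M,n)$ be a base point all of whose coordinates have orbits of free type. Let $\overline{\bf x}\in F(M/G,n)$ and $\widehat{\overline{\bf x}}\in F(M/G,n)/\Sigma_n$ be the images of ${\bf x}$. If the action of $G$ on $M$ is free, then (1) $\mathcal{P}_n^{orb}(M,G)\cong P_n(M/G)$, so $\mathcal{P}_n^{orb}(M,G)$ is realizable as $\pi_1(F(M/G,n),\overline{\bf x})$; (2) $\mathcal{B}_n^{orb}(M,G)\cong B_n(M/G)$, so $\mathcal{B}_n^{orb}(M,G)$ is realizable as $\pi_1(F(M/G,n)/\Sigma_n,\widehat{\overline{\bf x}})$.
   Context: $F_G(M,n)=\{(y_1,\dots,y_n)\in M^{\times n}\mid G(y_i)\cap G(y_j)=\emptyset \text{ for } i\neq j\}$; for a space $X$, $F(X,n)=\{(y_1,\dots,y_n)\in X^{\times n}\mid y_i\ne y_j\text{ for }i\neq j\}$, $P_n(X)=\pi_1(F(X,n))$, $B_n(X)=\pi_1(F(X,n)/\Sigma_n)$. The projection $F_G(M,n)\to F_G(M,n)/G^{\times n}=F(M/G,n)$ is induced coordinatewise by $M\to M/G$. For an $n$-tuple $y$ (of points, paths or group elements) and $\sigma\in\Sigma_n$ put $y_\sigma=(y_{\sigma(1)},\dots,y_{\sigma(n)})$; $G^{\times n}$ acts coordinatewise. ${\bf x}^{orb}=\{g{\bf x}_\sigma\mid g\in G^{\times n},\sigma\in\Sigma_n\}$; an orbit is of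 free type if isotropy groups of its points are trivial. Orbit braid group: a path $\alpha:I\to F_G(M,n)$ with $\alpha(0)={\bf x}$, $\alpha(1)\in{\bf x}^{orb}$ determines the orbit braid $\widetilde{c(\alpha)}=\{\widetilde{c(\alpha_1)},\dots,\widetilde{c(\alpha_n)}\}$ (unordered), where $\widetilde{c(\alpha_i)}$ is the collection of the strings $\{(h\alpha_i(s),s)\mid s\in I\}\subset M\times I$, $h\in G$. Orbit braids $\widetilde{c(\alpha)},\widetilde{c(\beta)}$ are equivalent if there are paths $\alpha',\beta'$ in $F_G(M,n)$ with $\widetilde{c(\alpha')}=\widetilde{c(\alpha)}$, $\widetilde{c(\beta')}=\widetilde{c(\beta)}$ and $\alpha'\simeq\beta'$ rel $\partial I$. $\mathcal{B}_n^{orb}(M,G)$ is the group of equivalence classes with product $[\widetilde{c(\alpha)}]*[\widetilde{c(\beta)}]=[\widetilde{c(\alpha\circ(g\beta_\sigma))}]$, where $\alpha(0)=\beta(0)={\bf x}$, $\alpha(1)=g{\bf x}_\sigma$ and $\circ$ is concatenation. $\mathcal{P}_n^{orb}(M,G)$ is the subgroup of classes with $\alpha(0)={\bf x}$, $\alpha(1)\in G^{\times n}({\bf x})$. *)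

(* Defs.v *)
From HB Require Import structures.
From mathcomp Require Import all_boot all_order all_algebra fingroup perm.
From mathcomp Require Import generic_quotient ring lra.
From mathcomp Require Import all_classical reals topology normedtype homotopy.

Set Implicit Arguments.
Unset Strict Implicit.
Unset Printing Implicit Defensive.

Import Order.TTheory GRing.Theory Num.Theory.
Import numFieldNormedType.Exports.

Local Open Scope classical_set_scope.
Local Open Scope ring_scope.
Local Open Scope quotient_scope.

Definition unit_interval (R : realType) : Type := set_type `[0 : R, 1]%classic.

HB.instance Definition _ (R : realType) :=
  Topological.copy (unit_interval R) (set_type `[0 : R, 1]%classic).

Section UnitInterval.
Context {R : realType}.
Notation I := (unit_interval R).

Definition ui_val (t : I) : R := set_val t.

Lemma ui_val_continuous : continuous ui_val.
Proof. exact: initial_continuous. Qed.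

Lemma ui_val_ge0 t : 0 <= ui_val t.
Proof. by have /= := set_valP t; rewrite in_itv/= => /andP[]. Qed.

Lemma ui_val_le1 t : ui_val t <= 1.
Proof. by have /= := set_valP t; rewrite in_itv/= => /andP[]. Qed.

Lemma ui_val_inj : injective ui_val.
Proof. by move=> s t st; apply: val_inj. Qed.

Definition clampR (r : R) : R := if r <= 0 then 0 else if r <= 1 then r else 1.

Lemma clamp_subproof r : clampR r \in `[0 : R, 1]%classic.
Proof.
rewrite inE/= in_itv/= /clampR.
by case: ifPn => [|r0]; [lra|case: ifPn => r1; lra].
Qed.

(* the retraction of R onto the unit interval *)
Definition clamp (r : R) : I := SigSub (clamp_subproof r).

Lemma val_clamp r : 0 <= r <= 1 -> ui_val (clamp r) = r.
Proof.
move=> r01; rewrite -[LHS]/(clampR r) /clampR.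
by case: ifPn => [|r0]; [lra|case: ifPn => //; lra].
Qed.

Lemma clampK : cancel ui_val clamp.
Proof.
move=> t; apply: ui_val_inj; apply: val_clamp.
by rewrite (ui_val_ge0 t) (ui_val_le1 t).
Qed.

Lemma zero_one_subproof : clamp 0 != clamp 1.
Proof.
apply/eqP => /(congr1 ui_val); rewrite !val_clamp; [|lra|lra].
by move/eqP; rewrite eq_sym oner_eq0.
Qed.

HB.instance Definition _ := @isBiPointed.Build I _ _ zero_one_subproof.

Lemma clamp0 : clamp 0 = zero. Proof. by []. Qed.
Lemma clamp1 : clamp 1 = one. Proof. by []. Qed.

Lemma ui_val0 : ui_val zero = 0. Proof. by rewrite val_clamp//; lra. Qed.
Lemma ui_val1 : ui_val one = 1. Proof. by rewrite val_clamp//; lra. Qed.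

Lemma paste_continuous (X Y : topologicalType) (u : X -> R) (c : R)
    (f g : X -> Y) :
  continuous u -> continuous f -> continuous g ->
  (forall x, u x = c -> f x = g x) ->
  continuous (fun x => if u x <= c then f x else g x).
Proof.
move=> cu cf cg fg x.
rewrite /continuous_at; case: (ltgtP (u x) c) => ux.
- suff E : \forall y \near x, f y = (if u y <= c then f y else g y).
    exact: cvg_trans (near_eq_cvg E) (cf x).
  have : \forall y \near x, u y < c by exact: (cvgr_lt _ (cu x)).
  by apply: filterS => y /ltW ->.
- suff E : \forall y \near x, g y = (if u y <= c then f y else g y).
    exact: cvg_trans (near_eq_cvg E) (cg x).
  have : \forall y \near x, c < u y by exact: (cvgr_gt _ (cu x)).
  by apply: filterS => y; rewrite ltNge => /negbTE ->.
- move=> A /= nA; have fA : nbhs x (f @^-1` A) by exact: (cf x).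
  have gA : nbhs x (g @^-1` A) by apply: (cg x); rewrite -(fg _ ux).
  change (nbhs x ((fun y => if u y <= c then f y else g y) @^-1` A)).
  apply: filterS (filterI fA gA) => y [/= Af Ag].
  by case: ifPn.
Qed.

Lemma clampR_continuous : continuous clampR.
Proof.
have ck (k : R) : continuous (fun _ : R => k) by move=> ?; exact: cvg_cst.
have ci : continuous (fun r : R => r) by move=> ?; exact: cvg_id.
have c1 := paste_continuous ci ci (ck 1) (c := 1) (fun _ e => e).
apply: (paste_continuous ci (ck 0) c1) => _ ->.
by rewrite ler01.
Qed.

Lemma clamp_continuous : continuous clamp.
Proof. apply: continuous_comp_initial; exact: clampR_continuous. Qed.

End UnitInterval.

Lemma comp_continuous (X Y Z : topologicalType) (f : X -> Y) (g : Y -> Z) :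
  continuous f -> continuous g -> continuous (fun x => g (f x)).
Proof. by move=> cf cg x; apply: (continuous_comp (cf x) (cg (f x))). Qed.

Lemma pair_continuous (X Y Z : topologicalType) (f : X -> Y) (g : X -> Z) :
  continuous f -> continuous g -> continuous (fun x => (f x, g x)).
Proof. by move=> cf cg x; apply: cvg_pair; [exact: cf|exact: cg]. Qed.

Lemma const_continuous (X Y : topologicalType) (y : Y) :
  continuous (fun _ : X => y).
Proof. by move=> x; exact: cvg_cst. Qed.

Section Homotopy.
Context {R : realType}.
Notation I := (unit_interval R).

(* homotopy relative to the two endpoints; the first coordinate of [I * I] is
   the path parameter, the second one the deformation parameter *)
Definition path_homotopic (X : topologicalType) (f g : I -> X) : Prop :=
  exists H : I * I -> X, [/\ continuous H,
    forall s, H (s, zero) = f s,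
    forall s, H (s, one) = g s,
    forall t, H (zero, t) = f zero &
    forall t, H (one, t) = f one].

Definition path_cat (X : Type) (f g : I -> X) : I -> X := fun t =>
  if ui_val t <= 2^-1 then f (clamp (2 * ui_val t))
  else g (clamp (2 * ui_val t - 1)).

Definition path_rev (X : Type) (f : I -> X) : I -> X :=
  fun t => f (clamp (1 - ui_val t)).

Let Dcont (X : topologicalType) (u v : X -> R) :
  continuous u -> continuous v -> continuous (fun x => u x + v x).
Proof. by move=> cu cv x; apply: continuousD; [exact: cu|exact: cv]. Qed.

Let Bcont (X : topologicalType) (u v : X -> R) :
  continuous u -> continuous v -> continuous (fun x => u x - v x).
Proof. by move=> cu cv x; apply: continuousB; [exact: cu|exact: cv]. Qed.

Let Mcont (X : topologicalType) (u v : X -> R) :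
  continuous u -> continuous v -> continuous (fun x => u x * v x).
Proof. by move=> cu cv x; apply: continuousM; [exact: cu|exact: cv]. Qed.

Let Kcont := const_continuous.

Let Icont (X : topologicalType) : continuous (fun x : X => x).
Proof. by move=> x; exact: cvg_id. Qed.

Let fst_cont (X Y : topologicalType) : continuous (fun p : X * Y => p.1).
Proof. by move=> p; exact: cvg_fst. Qed.

Let snd_cont (X Y : topologicalType) : continuous (fun p : X * Y => p.2).
Proof. by move=> p; exact: cvg_snd. Qed.

Let clampP (X : topologicalType) (u : X -> R) :
  continuous u -> continuous (fun x => clamp (u x) : I).
Proof. by move=> cu; exact: comp_continuous cu (@clamp_continuous R). Qed.

Let dcont : continuous (fun t : I => 2 * ui_val t).
Proof. exact: (Mcont (@Kcont _ _ _) (@ui_val_continuous R)). Qed.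

Let d1cont : continuous (fun t : I => 2 * ui_val t - 1).
Proof. exact: (Bcont dcont (@Kcont _ _ _)). Qed.

Let clampz (r : R) : r <= 0 -> clamp r = zero :> I.
Proof.
move=> r0; rewrite -clamp0; apply: ui_val_inj.
by rewrite -[LHS]/(clampR r) -[RHS]/(clampR 0) /clampR r0 lexx.
Qed.

Let clampo (r : R) : 1 <= r -> clamp r = one :> I.
Proof.
move=> r0; rewrite -clamp1; apply: ui_val_inj.
rewrite -[LHS]/(clampR r) -[RHS]/(clampR 1) /clampR lexx.
by case: ifPn => [|_]; [lra|case: ifPn; case: ifPn; lra].
Qed.

Section PathCat.
Variable X : topologicalType.
Implicit Types f g h : I -> X.

Lemma path_cat0 f g : path_cat f g zero = f zero.
Proof. by rewrite /path_cat ui_val0 invr_ge0 ler0n mulr0 clamp0. Qed.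

Lemma path_cat1 f g : path_cat f g one = g one.
Proof.
rewrite /path_cat ui_val1 ifN; last by rewrite -ltNge; lra.
by rewrite clampo//; lra.
Qed.

Lemma path_rev0 f : path_rev f zero = f one.
Proof. by rewrite /path_rev ui_val0 clampo//; lra. Qed.

Lemma path_rev1 f : path_rev f one = f zero.
Proof. by rewrite /path_rev ui_val1 clampz//; lra. Qed.

Lemma path_cat_continuous f g : continuous f -> continuous g ->
  f one = g zero -> continuous (path_cat f g).
Proof.
move=> cf cg fg; apply: (paste_continuous (@ui_val_continuous R)).
- exact: comp_continuous (clampP dcont) cf.
- exact: comp_continuous (clampP d1cont) cg.
- by move=> t ->; rewrite clampo ?clampz//; lra.
Qed.

Lemma path_rev_continuous f : continuous f -> continuous (path_rev f).
Proof.
move=> cf; apply: comp_continuous cf; apply: clampP.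
exact: (Bcont (@Kcont _ _ _) (@ui_val_continuous R)).
Qed.

Lemma homotopic_reparam f (p q : I -> I) :
  continuous f -> continuous p -> continuous q ->
  p zero = q zero -> p one = q one ->
  path_homotopic (fun t => f (p t)) (fun t => f (q t)).
Proof.
move=> cf cp cq p0 p1.
exists (fun st => f (clamp (ui_val (p st.1) +
  ui_val st.2 * (ui_val (q st.1) - ui_val (p st.1))))); split => /=.
- apply: comp_continuous cf; apply: clampP.
  have cp1 : continuous (fun st : I * I => ui_val (p st.1)).
    apply: comp_continuous (@ui_val_continuous R).
    exact: comp_continuous (@fst_cont _ _) cp.
  have cq1 : continuous (fun st : I * I => ui_val (q st.1)).
    apply: comp_continuous (@ui_val_continuous R).
    exact: comp_continuous (@fst_cont _ _) cq.
  apply: Dcont => //; apply: Mcont; last exact: Bcont.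
  exact: comp_continuous (@snd_cont _ _) (@ui_val_continuous R).
- by move=> s; rewrite ui_val0 mul0r addr0 clampK.
- by move=> s; rewrite ui_val1 mul1r addrC subrK clampK.
- by move=> t; rewrite p0 subrr mulr0 addr0 clampK.
- by move=> t; rewrite p1 subrr mulr0 addr0 clampK.
Qed.

Lemma path_homotopic_refl f : continuous f -> path_homotopic f f.
Proof.
move=> cf; exists (fun st => f st.1); split => //.
exact: comp_continuous (@fst_cont _ _) cf.
Qed.

Lemma path_homotopic_ends f g : path_homotopic f g ->
  f zero = g zero /\ f one = g one.
Proof. by move=> [H [_ H0 H1 Hz Ho]]; rewrite -(Hz one) -(Ho one) !H1. Qed.

Lemma path_homotopic_sym f g : path_homotopic f g -> path_homotopic g f.
Proof.
move=> fg; have [e0 e1] := path_homotopic_ends fg.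
case: fg => H [cH H0 H1 Hz Ho].
exists (fun st => H (st.1, clamp (1 - ui_val st.2))); split => /=.
- apply: comp_continuous cH; apply: pair_continuous; first exact: fst_cont.
  apply: clampP; apply: Bcont; first exact: Kcont.
  exact: comp_continuous (@snd_cont _ _) (@ui_val_continuous R).
- by move=> s; rewrite ui_val0 subr0 clamp1.
- by move=> s; rewrite ui_val1 clampz// subrr.
- by move=> t; rewrite Hz.
- by move=> t; rewrite Ho.
Qed.

Lemma path_homotopic_trans f g h :
  path_homotopic f g -> path_homotopic g h -> path_homotopic f h.
Proof.
move=> fg; have [e0 e1] := path_homotopic_ends fg.
case: fg => H [cH H0 H1 Hz Ho] [K [cK K0 K1 Kz Ko]].
have csnd : continuous (fun st : I * I => ui_val st.2).
  exact: comp_continuous (@snd_cont _ _) (@ui_val_continuous R).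
exists (fun st => if ui_val st.2 <= 2^-1 then H (st.1, clamp (2 * ui_val st.2))
  else K (st.1, clamp (2 * ui_val st.2 - 1))); split => /=.
- apply: (paste_continuous csnd).
  + apply: comp_continuous cH; apply: pair_continuous; first exact: fst_cont.
    exact: comp_continuous (@snd_cont _ _) (clampP dcont).
  + apply: comp_continuous cK; apply: pair_continuous; first exact: fst_cont.
    exact: comp_continuous (@snd_cont _ _) (clampP d1cont).
  + by move=> st ->; rewrite clampo ?clampz ?H1 ?K0//; lra.
- by move=> s; rewrite ui_val0 invr_ge0 ler0n mulr0 clamp0.
- move=> s; rewrite ui_val1 ifN; last by rewrite -ltNge; lra.
  by rewrite clampo//; lra.
- by move=> t; rewrite Hz Kz e0; case: ifP.
- by move=> t; rewrite Ho Ko e1; case: ifP.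
Qed.

Lemma path_homotopic_comp (Y : topologicalType) (k : X -> Y) f g :
  continuous k -> path_homotopic f g ->
  path_homotopic (fun t => k (f t)) (fun t => k (g t)).
Proof.
move=> ck [H [cH H0 H1 Hz Ho]]; exists (fun st => k (H st)).
by split=> [|s|s|t|t]; rewrite ?H0 ?H1 ?Hz ?Ho//; exact: comp_continuous cH ck.
Qed.

Lemma path_cat_comp (Y : Type) (k : X -> Y) f g :
  (fun t => k (path_cat f g t)) =
  path_cat (fun t => k (f t)) (fun t => k (g t)).
Proof. by apply/funext => t; rewrite /path_cat; case: ifP. Qed.

Lemma path_cat_homotopic f f' g g' : f one = g zero ->
  path_homotopic f f' -> path_homotopic g g' ->
  path_homotopic (path_cat f g) (path_cat f' g').
Proof.
move=> fg [H [cH H0 H1 Hz Ho]] [K [cK K0 K1 Kz Ko]].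
exists (fun st => if ui_val st.1 <= 2^-1 then H (clamp (2 * ui_val st.1), st.2)
  else K (clamp (2 * ui_val st.1 - 1), st.2)); split => /=.
- have cfst : continuous (fun st : I * I => ui_val st.1).
    exact: comp_continuous (@fst_cont _ _) (@ui_val_continuous R).
  apply: (paste_continuous cfst).
  + apply: comp_continuous cH; apply: pair_continuous; last exact: snd_cont.
    exact: comp_continuous (@fst_cont _ _) (clampP dcont).
  + apply: comp_continuous cK; apply: pair_continuous; last exact: snd_cont.
    exact: comp_continuous (@fst_cont _ _) (clampP d1cont).
  + by move=> st ->; rewrite clampo ?clampz ?Ho ?Kz//; lra.
- by move=> s; rewrite H0 K0.
- by move=> s; rewrite H1 K1.
- move=> t; rewrite path_cat0 ui_val0 invr_ge0 ler0n mulr0 clamp0.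
  exact: Hz.
- move=> t; rewrite path_cat1 ui_val1 ifN; last by rewrite -ltNge; lra.
  by rewrite clampo//; lra.
Qed.

Lemma path_cat1f f : continuous f ->
  path_homotopic (path_cat (fun=> f zero) f) f.
Proof.
move=> cf; have -> : path_cat (fun=> f zero) f =
    (fun t => f (clamp (2 * ui_val t - 1))).
  by apply/funext => t; rewrite /path_cat; case: ifP => // t2; rewrite clampz//; lra.
apply: (@homotopic_reparam f _ id) => //; [exact: clampP|exact: Icont| |].
- by rewrite ui_val0 clampz//; lra.
- by rewrite ui_val1 clampo//; lra.
Qed.

Lemma path_catf1 f : continuous f ->
  path_homotopic (path_cat f (fun=> f one)) f.
Proof.
move=> cf; have -> : path_cat f (fun=> f one) =
    (fun t => f (clamp (2 * ui_val t))).
  apply/funext => t; rewrite /path_cat; case: ifPn => //.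
  by rewrite -ltNge => t2; rewrite clampo//; lra.
apply: (@homotopic_reparam f _ id) => //; [exact: clampP|exact: Icont| |].
- by rewrite ui_val0 clampz//; lra.
- by rewrite ui_val1 clampo//; lra.
Qed.

End PathCat.

Lemma path_catfV (X : topologicalType) (f : I -> X) : continuous f ->
  path_homotopic (path_cat f (path_rev f)) (fun=> f zero).
Proof.
move=> cf; rewrite -(@path_cat_comp I _ f id (path_rev id)).
apply: (@homotopic_reparam _ f _ (fun=> zero)) => //.
- apply: path_cat_continuous; [exact: Icont| |by rewrite path_rev0].
  by apply: path_rev_continuous; exact: Icont.
- exact: Kcont.
- by rewrite path_cat0.
- by rewrite path_cat1 path_rev1.
Qed.

Lemma path_catVf (X : topologicalType) (f : I -> X) : continuous f ->
  path_homotopic (path_cat (path_rev f) f) (fun=> f one).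
Proof.
move=> cf; rewrite -(@path_cat_comp I _ f (path_rev id) id).
apply: (@homotopic_reparam _ f _ (fun=> one)) => //.
- apply: path_cat_continuous; [|exact: Icont|by rewrite path_rev1].
  by apply: path_rev_continuous; exact: Icont.
- exact: Kcont.
- by rewrite path_cat0 path_rev0.
- by rewrite path_cat1.
Qed.

Lemma path_catA (X : topologicalType) (f g h : I -> X) :
  continuous f -> continuous g -> continuous h ->
  f one = g zero -> g one = h zero ->
  path_homotopic (path_cat (path_cat f g) h) (path_cat f (path_cat g h)).
Proof.
move=> cf cg ch fg gh; set k := path_cat f (path_cat g h).
have ck : continuous k.
  apply: path_cat_continuous => //; last by rewrite path_cat0.
  exact: path_cat_continuous.
pose p (r : R) := if r <= 4^-1 then 2 * r else
  if r <= 2^-1 then r + 4^-1 else 2^-1 * (r + 1).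
have cp : continuous p.
  have c1 : continuous (fun r : R => r + 4^-1).
    by apply: Dcont; [exact: Icont|exact: Kcont].
  have c2 : continuous (fun r : R => 2^-1 * (r + 1)).
    apply: Mcont; first exact: Kcont.
    by apply: Dcont; [exact: Icont|exact: Kcont].
  have c3 : continuous (fun r : R => 2 * r).
    by apply: Mcont; [exact: Kcont|exact: Icont].
  apply: (paste_continuous (@Icont _) c3).
    by apply: (paste_continuous (@Icont _) c1 c2) => r ->; lra.
  by move=> r ->; rewrite ifT; lra.
have -> : path_cat (path_cat f g) h = (fun t => k (clamp (p (ui_val t)))).
  apply/funext => t; have t0 := ui_val_ge0 t; have t1 := ui_val_le1 t.
  rewrite /k /path_cat /p; case: (boolP (ui_val t <= 4^-1)) => t4.
    have t2 : ui_val t <= 2^-1 by lra.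
    rewrite t2 (@val_clamp _ (2 * ui_val t)); last lra.
    by have -> : 2 * ui_val t <= 2^-1 by lra.
  rewrite -ltNge in t4; case: (boolP (ui_val t <= 2^-1)) => t2.
    rewrite !(@val_clamp _ (2 * ui_val t)); last lra.
    rewrite !(@val_clamp _ (ui_val t + 4^-1)); last lra.
    rewrite ifN -?ltNge; last lra.
    rewrite [in RHS]ifN -?ltNge; last lra.
    rewrite (@val_clamp _ (2 * (ui_val t + 4^-1) - 1)); last lra.
    rewrite ifT; last lra.
    by congr (g (clamp _)); lra.
  rewrite -ltNge in t2.
  rewrite !(@val_clamp _ (2^-1 * (ui_val t + 1))); last lra.
  rewrite ifN -?ltNge; last lra.
  rewrite (@val_clamp _ (2 * (2^-1 * (ui_val t + 1)) - 1)); last lra.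
  rewrite ifN -?ltNge; last lra.
  by congr (h (clamp _)); lra.
apply: (@homotopic_reparam _ k _ id) => //.
- apply: clampP; exact: comp_continuous (@ui_val_continuous R) cp.
- exact: Icont.
- by rewrite /p ui_val0 ifT ?clampz//; lra.
- rewrite /p ui_val1 ifN ?ifN -?ltNge; [|lra|lra].
  by rewrite clampo//; lra.
Qed.

End Homotopy.

Lemma ptws_continuous (J : Type) (X Y : topologicalType)
    (f : X -> {ptws J -> Y}) :
  (forall j, continuous (fun x => f x j)) -> continuous f.
Proof.
move=> cf x; apply/cvg_sup => j.
exact: (@continuous_comp_initial _ X Y (fun y : J -> Y => y j) f (cf j)).
Qed.

Lemma ptws_proj_continuous (J : eqType) (Y : topologicalType) (j : J) :
  continuous (fun y : {ptws J -> Y} => y j).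
Proof. by move=> y; exact: (@proj_continuous J (fun=> Y) j). Qed.

Definition homeomorphic (X Y : topologicalType) : Prop :=
  exists (f : X -> Y) (g : Y -> X),
    [/\ continuous f, continuous g, cancel f g & cancel g f].

(* without boundary *)
Definition topological_manifold (R : realType) (d : nat) (M : topologicalType)
    : Prop :=
  [/\ hausdorff_space M, @second_countable M &
    forall p : M, exists (U : set M) (V : set 'rV[R]_d),
      [/\ open U, U p, open V & homeomorphic U V]].

Definition group_isomorphic (A B : groupType) : Prop :=
  exists f : {multiplicative A -> B}, bijective f.

Section FundamentalGroup.
Variables (R : realType) (X : topologicalType) (x : X).
Notation I := (unit_interval R).
Notation loop := {path I from x to x in X}.
Implicit Types f g h : loop.

Let cf f : continuous f. Proof. exact: cts_fun. Qed.

Let end_start f g : f one = g zero. Proof. by rewrite path_one path_zero. Qed.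

Definition loop_homotopic f g : bool := `[< path_homotopic f g >].

Lemma loop_homotopic_refl : reflexive loop_homotopic.
Proof. by move=> f; apply/asboolP; exact: path_homotopic_refl. Qed.

Lemma loop_homotopic_sym : symmetric loop_homotopic.
Proof.
by move=> f g; apply/asboolP/asboolP; exact: path_homotopic_sym.
Qed.

Lemma loop_homotopic_trans : transitive loop_homotopic.
Proof.
move=> f g h /asboolP gf /asboolP fh.
by apply/asboolP; exact: path_homotopic_trans gf fh.
Qed.

Canonical loop_homotopic_equiv := EquivRel loop_homotopic
  loop_homotopic_refl loop_homotopic_sym loop_homotopic_trans.

Definition loop_cat f g : loop :=
  mk_path (path_cat_continuous (@cf f) (@cf g) (end_start f g))
    (etrans (path_cat0 f g) path_zero) (etrans (path_cat1 f g) path_one).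

Definition loop_rev f : loop :=
  mk_path (path_rev_continuous (@cf f))
    (etrans (path_rev0 f) path_one) (etrans (path_rev1 f) path_zero).

Definition loop_cst : loop := cst x : I -> X.

Definition pi1 : Type := {eq_quot loop_homotopic_equiv}.
HB.instance Definition _ := Choice.on pi1.
HB.instance Definition _ := EqQuotient.on pi1.

Definition pi1_mul (a b : pi1) : pi1 := \pi_pi1 (loop_cat (repr a) (repr b)).
Definition pi1_inv (a : pi1) : pi1 := \pi_pi1 (loop_rev (repr a)).
Definition pi1_one : pi1 := \pi_pi1 loop_cst.

Lemma pi1_eqP f g : \pi_pi1 f = \pi_pi1 g <-> path_homotopic f g.
Proof.
split; first by move=> /eqquotP /asboolP.
by move=> fg; apply/eqquotP/asboolP.
Qed.

Lemma pi1_reprP f : path_homotopic (repr (\pi_pi1 f)) f.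
Proof. by apply/pi1_eqP; rewrite reprK. Qed.

Lemma pi1_mulE f g : pi1_mul (\pi f) (\pi g) = \pi_pi1 (loop_cat f g).
Proof.
by apply/pi1_eqP; apply: path_cat_homotopic => //; exact: pi1_reprP.
Qed.

Lemma pi1_mulA : associative pi1_mul.
Proof.
move=> a b c; rewrite -[a]reprK -[b]reprK -[c]reprK !pi1_mulE.
by apply/pi1_eqP; apply: path_homotopic_sym; exact: path_catA.
Qed.

Lemma pi1_mul1g : left_id pi1_one pi1_mul.
Proof.
move=> a; rewrite -[a]reprK pi1_mulE; apply/pi1_eqP.
by have := path_cat1f (@cf (repr a)); rewrite path_zero.
Qed.

Lemma pi1_mulg1 : right_id pi1_one pi1_mul.
Proof.
move=> a; rewrite -[a]reprK pi1_mulE; apply/pi1_eqP.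
by have := path_catf1 (@cf (repr a)); rewrite path_one.
Qed.

Lemma pi1_mulVg : left_inverse pi1_one pi1_inv pi1_mul.
Proof.
move=> a; rewrite -[X in pi1_mul _ X]reprK pi1_mulE.
by apply/pi1_eqP; have := path_catVf (@cf (repr a)); rewrite path_one.
Qed.

Lemma pi1_mulgV : right_inverse pi1_one pi1_inv pi1_mul.
Proof.
move=> a; rewrite -[X in pi1_mul X _]reprK pi1_mulE.
by apply/pi1_eqP; have := path_catfV (@cf (repr a)); rewrite path_zero.
Qed.

HB.instance Definition _ := isGroup.Build pi1
  pi1_mulA pi1_mul1g pi1_mulg1 pi1_mulVg pi1_mulgV.

End FundamentalGroup.

Record gaction (G : finGroupType) (M : topologicalType) := GAction {
  gact :> G -> M -> M;
  gact1 : forall p, gact 1%g p = p;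
  gactM : forall g h p, gact (g * h)%g p = gact g (gact h p);
  gact_continuous : forall g, continuous (gact g)
}.

Section Action.
Variables (G : finGroupType) (M : topologicalType) (act : gaction G M).

Definition gorbit (p : M) : set M := [set act g p | g in [set: G]].

Definition effective_action : Prop :=
  forall g, (forall p, act g p = p) -> g = 1%g.

Definition free_action : Prop := forall g p, act g p = p -> g = 1%g.

Definition free_type_orbit (O : set M) : Prop :=
  forall p, O p -> forall g, act g p = p -> g = 1%g.

Lemma gactK g : cancel (act g) (act g^-1%g).
Proof. by move=> p; rewrite -gactM mulVg gact1. Qed.

Lemma gactKV g : cancel (act g^-1%g) (act g).
Proof. by move=> p; rewrite -gactM mulgV gact1. Qed.

Lemma gorbit_refl p : gorbit p p.
Proof. by exists 1%g => //; rewrite gact1. Qed.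

Lemma gorbit_act g p : gorbit (act g p) = gorbit p.
Proof.
apply/seteqP; split=> [_ [h _ <-]|_ [h _ <-]].
  by exists (h * g)%g => //; rewrite gactM.
by exists (h * g^-1)%g => //; rewrite gactM gactK.
Qed.

Lemma gorbit_eq p q : gorbit p q -> gorbit q = gorbit p.
Proof. by move=> [g _ <-]; exact: gorbit_act. Qed.

Definition same_orbit (p q : M) : bool := `[< gorbit p q >].

Lemma same_orbit_refl : reflexive same_orbit.
Proof. by move=> p; apply/asboolP; exact: gorbit_refl. Qed.

Lemma same_orbit_sym : symmetric same_orbit.
Proof.
by move=> p q; apply/asboolP/asboolP => /gorbit_eq E; rewrite ?E -?E;
   [rewrite E|rewrite E]; exact: gorbit_refl.
Qed.

Lemma same_orbit_trans : transitive same_orbit.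
Proof.
move=> p q r /asboolP qp /asboolP pr.
by apply/asboolP; rewrite -(gorbit_eq qp).
Qed.

Canonical same_orbit_equiv := EquivRel same_orbit
  same_orbit_refl same_orbit_sym same_orbit_trans.

Definition orbit_space : topologicalType :=
  quotient_topology {eq_quot same_orbit_equiv}.

Definition orbit_proj (p : M) : orbit_space := \pi_({eq_quot same_orbit_equiv}) p.

End Action.

Definition conf (X : topologicalType) (n : nat) : set {ptws 'I_n -> X} :=
  [set y | forall i j, i != j -> y i <> y j].
Arguments conf : clear implicits.

Section UnorderedConf.
Variables (X : topologicalType) (n : nat).

Lemma conf_perm_subproof (s : 'S_n) (y : conf X n) :
  (fun i => set_val y (s i)) \in conf X n.
Proof.
apply/mem_set => i j ij; apply: (set_valP y).
by rewrite (inj_eq perm_inj).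
Qed.

Definition conf_perm (s : 'S_n) (y : conf X n) : conf X n :=
  SigSub (conf_perm_subproof s y).

Definition same_conf (y z : conf X n) : bool :=
  `[< exists s : 'S_n, z = conf_perm s y >].

Lemma conf_perm1 y : conf_perm 1%g y = y.
Proof. by apply: val_inj; apply/funext => i /=; rewrite perm1. Qed.

Lemma conf_permM s t y : conf_perm (s * t)%g y = conf_perm s (conf_perm t y).
Proof. by apply: val_inj; apply/funext => i /=; rewrite permM. Qed.

Lemma same_conf_refl : reflexive same_conf.
Proof. by move=> y; apply/asboolP; exists 1%g; rewrite conf_perm1. Qed.

Lemma same_conf_sym : symmetric same_conf.
Proof.
move=> y z; apply/asboolP/asboolP => -[s ->]; exists s^-1%g;
  by rewrite -conf_permM mulVg conf_perm1.
Qed.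

Lemma same_conf_trans : transitive same_conf.
Proof.
move=> y z w /asboolP[s ->] /asboolP[t ->].
by apply/asboolP; exists (t * s)%g; rewrite conf_permM.
Qed.

Canonical same_conf_equiv := EquivRel same_conf
  same_conf_refl same_conf_sym same_conf_trans.

Definition unordered_conf : topologicalType :=
  quotient_topology {eq_quot same_conf_equiv}.

Definition unordered_proj (y : conf X n) : unordered_conf :=
  \pi_({eq_quot same_conf_equiv}) y.

End UnorderedConf.

Definition pure_braid_group (R : realType) (X : topologicalType) (n : nat)
  (y : conf X n) := pi1 R y.

Definition braid_group (R : realType) (X : topologicalType) (n : nat)
  (y : conf X n) := pi1 R (unordered_proj y).

Definition orbit_conf (G : finGroupType) (M : topologicalType)
    (act : gaction G M) (n : nat) : set {ptws 'I_n -> M} :=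
  [set y | forall i j, i != j -> gorbit act (y i) `&` gorbit act (y j) = set0].
Arguments orbit_conf {G M} act n _.

Section OrbitConf.
Variables (G : finGroupType) (M : topologicalType) (act : gaction G M).
Variable n : nat.

Notation F := (orbit_conf act n).

Lemma orbit_conf_inj (y : F) i j :
  gorbit act (set_val y i) = gorbit act (set_val y j) -> i = j.
Proof.
move=> yij; apply/eqP; apply: contraT => ij.
have yij0 : gorbit act (set_val y i) `&` gorbit act (set_val y j) = set0.
  exact: (set_valP y).
have := gorbit_refl act (set_val y j).
by rewrite -[gorbit _ _]setIid -[X in X `&` _]yij yij0.
Qed.

Lemma orbit_proj_conf_subproof (y : F) :
  (fun i => orbit_proj act (set_val y i)) \in conf (orbit_space act) n.
Proof.
apply/mem_set => i j ij /= /eqquotP /asboolP /gorbit_eq yij.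
by move/eqP: ij; apply; apply: (@orbit_conf_inj y).
Qed.

Definition orbit_proj_conf (y : F) : conf (orbit_space act) n :=
  SigSub (orbit_proj_conf_subproof y).

Lemma conf_act_subproof (g : 'I_n -> G) (s : 'S_n) (y : F) :
  (fun i => act (g i) (set_val y (s i))) \in F.
Proof.
apply/mem_set => i j ij /=; rewrite !gorbit_act; apply: (set_valP y).
by rewrite (inj_eq perm_inj).
Qed.

(* [g y_s], where [y_s] is the tuple [i |-> y (s i)]; since [(s * t) i = t (s i)]
   in the group ['S_n], one has [y_(s * t) = (y_t)_s] *)
Definition conf_act (g : 'I_n -> G) (s : 'S_n) (y : F) : F :=
  SigSub (conf_act_subproof g s y).

Lemma conf_act_continuous g s : continuous (conf_act g s).
Proof.
apply: continuous_comp_initial; apply: ptws_continuous => i.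
apply: (@comp_continuous _ _ _ (fun y : F => set_val y (s i)));
  last exact: gact_continuous.
apply: (@comp_continuous _ _ _ (fun y : F => set_val y)
  (fun y => y (s i))); first exact: initial_continuous.
exact: ptws_proj_continuous.
Qed.

Lemma conf_act1 y : conf_act (fun=> 1%g) 1%g y = y.
Proof. by apply: val_inj; apply/funext => i /=; rewrite perm1 gact1. Qed.

Lemma conf_actM g s h t y : conf_act g s (conf_act h t y) =
  conf_act (fun i => g i * h (s i))%g (s * t)%g y.
Proof. by apply: val_inj; apply/funext => i /=; rewrite permM gactM. Qed.

Definition act_inv (g : 'I_n -> G) (s : 'S_n) (i : 'I_n) : G :=
  ((g ((s^-1 : 'S_n) i))^-1)%g.

Lemma conf_actK g s :
  cancel (conf_act g s) (conf_act (act_inv g s) s^-1%g).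
Proof.
move=> y; rewrite conf_actM; apply: val_inj; apply/funext => i /=.
by rewrite /act_inv mulVg mulVg perm1 gact1.
Qed.

Lemma conf_actKV g s :
  cancel (conf_act (act_inv g s) s^-1%g) (conf_act g s).
Proof.
move=> y; rewrite conf_actM; apply: val_inj; apply/funext => i /=.
by rewrite /act_inv permK mulgV mulgV perm1 gact1.
Qed.

Definition base_orbit (x : F) : set F :=
  [set y | exists g s, y = conf_act g s x].

Section Braid.
Variable R : realType.
Notation I := (unit_interval R).

Definition braid_string (a : I -> M) : set (M * I) := [set (a t, t) | t in [set: I]].

Definition string_orbit (a : I -> M) : set (set (M * I)) :=
  [set braid_string (fun t => act h (a t)) | h in [set: G]].

Definition orbit_braid (a : I -> F) : set (set (set (M * I))) :=
  [set string_orbit (fun t => set_val (a t) i) | i in [set: 'I_n]].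

(* the representing paths need not start at the base point *)
Definition orbit_braid_equiv (b c : set (set (set (M * I)))) : Prop :=
  exists a a' : I -> F, [/\ continuous a, continuous a',
    orbit_braid a = b, orbit_braid a' = c & path_homotopic a a'].

Definition orbit_braids (x : F) : set (set (set (set (M * I)))) :=
  [set b | exists (y : F) (a : {path I from x to y in F}),
    base_orbit x y /\ orbit_braid a = b].

Lemma braid_string_inj : injective braid_string.
Proof.
move=> a b E; apply/funext => t.
have : braid_string b (a t, t) by rewrite -E; exists t.
by move=> [u _ [<- ->]].
Qed.

Lemma orbit_braid_eq a b : orbit_braid a = orbit_braid b ->
  exists g s, a = (fun t => conf_act g s (b t)).
Proof.
move=> E.
have /choice[f fP] : forall i : 'I_n, exists gj : G * 'I_n,
    forall t, set_val (a t) i = act gj.1 (set_val (b t) gj.2).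
  move=> i.
  have : orbit_braid b (string_orbit (fun t => set_val (a t) i)).
    by rewrite -E; exists i.
  move=> [j _ Ej].
  have : string_orbit (fun t => set_val (b t) j)
      (braid_string (fun t => set_val (a t) i)).
    rewrite Ej; exists 1%g => //.
    by congr braid_string; apply/funext => t; rewrite gact1.
  move=> [h _ /braid_string_inj Eh]; exists (h, j) => t /=.
  by rewrite -[LHS]/((fun t => set_val (a t) i) t) -Eh.
have f2_inj : injective (fun i => (f i).2).
  move=> i k fik; apply: (@orbit_conf_inj (a zero)).
  by rewrite !fP !gorbit_act fik.
exists (fun i => (f i).1), (perm f2_inj); apply/funext => t.
by apply: val_inj; apply/funext => i /=; rewrite permE; exact: fP.
Qed.

End Braid.
End OrbitConf.

Arguments orbit_braids {G M act n} R x _.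

Section OrbitBraidGroup.
Variables (R : realType) (G : finGroupType) (M : topologicalType).
Variables (act : gaction G M) (n : nat) (x : orbit_conf act n).
Context (x_free : forall i, free_type_orbit act (gorbit act (set_val x i))).
Notation I := (unit_interval R).
Notation F := (orbit_conf act n).

Lemma conf_act_free g s h t :
  conf_act g s x = conf_act h t x -> g = h /\ s = t.
Proof.
move=> E.
have Ei i : act (g i) (set_val x (s i)) = act (h i) (set_val x (t i)).
  by rewrite -[LHS]/(set_val (conf_act g s x) i) E.
have st : s = t.
  apply/permP => i; apply: (@orbit_conf_inj _ _ act n x).
  by rewrite -(gorbit_act act (g i)) Ei gorbit_act.
split=> //; apply/funext => i; have := Ei i; rewrite st => Ei'.
have /x_free : gorbit act (set_val x (t i)) (set_val x (t i)).
  exact: gorbit_refl.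
move=> /(_ ((h i)^-1 * g i)%g); rewrite gactM Ei' gactK => /(_ erefl) /eqP.
by rewrite -eq_mulVg1 => /eqP.
Qed.

Lemma orbit_braid_equivP (a b : I -> F) : continuous a -> continuous b ->
  a zero = x -> b zero = x ->
  orbit_braid_equiv act n (orbit_braid a) (orbit_braid b) <-> path_homotopic a b.
Proof.
move=> ca cb a0 b0; split; last by exists a, b.
move=> [a' [b' [ca' cb' /orbit_braid_eq[g [s Ea]] /orbit_braid_eq[h [t Eb]]]]].
move: Ea Eb => -> -> ab; have [] := path_homotopic_ends ab.
rewrite a0 b0 => /conf_act_free[gh st] _; subst h t.
have := path_homotopic_comp
  (@conf_act_continuous _ _ _ _ (act_inv g s) s^-1%g) ab.
congr path_homotopic; apply/funext => u; exact: conf_actK.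
Qed.

(* a path from [x] to [g x_s], together with [g] and [s] *)
Record orbit_path := OrbitPath {
  op_g : 'I_n -> G;
  op_s : 'S_n;
  op_path :> {path I from x to conf_act op_g op_s x in F}
}.

Let cop (a : orbit_path) : continuous (a : I -> F). Proof. exact: cts_fun. Qed.

Let op0 (a : orbit_path) : (a : I -> F) zero = x. Proof. exact: path_zero. Qed.

Let op1 (a : orbit_path) : (a : I -> F) one = conf_act (op_g a) (op_s a) x.
Proof. exact: path_one. Qed.

Definition orbit_path_of (g : 'I_n -> G) (s : 'S_n) (f : I -> F)
    (cf : continuous f) (f0 : f zero = x) (f1 : f one = conf_act g s x) :=
  @OrbitPath g s (mk_path cf f0 f1).

Lemma orbit_braid_subproof (a : orbit_path) :
  orbit_braid (a : I -> F) \in orbit_braids R x.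
Proof.
apply/mem_set; exists (conf_act (op_g a) (op_s a) x), (op_path a).
by split=> //; exists (op_g a), (op_s a).
Qed.

Definition based_braid (a : orbit_path) : orbit_braids R x :=
  SigSub (orbit_braid_subproof a).

Lemma based_braid_surj (b : orbit_braids R x) :
  exists a : orbit_path, based_braid a = b.
Proof.
have [y [f [[g [s ys]] fb]]] := set_valP b; subst y.
by exists (@OrbitPath g s f); apply: val_inj.
Qed.

Definition based_path (b : orbit_braids R x) : orbit_path :=
  projT1 (cid (based_braid_surj b)).

Lemma based_pathK : cancel based_path based_braid.
Proof. by move=> b; rewrite /based_path; case: cid. Qed.

Definition based_equiv (b c : orbit_braids R x) : bool :=
  `[< orbit_braid_equiv act n (set_val b) (set_val c) >].

Lemma based_equivP (a b : orbit_path) :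
  reflect (path_homotopic (a : I -> F) b)
    (based_equiv (based_braid a) (based_braid b)).
Proof.
by apply: (equivP (asboolP _)); apply: orbit_braid_equivP.
Qed.

Lemma based_equiv_refl : reflexive based_equiv.
Proof.
move=> b; rewrite -[b]based_pathK; apply/based_equivP.
exact: path_homotopic_refl.
Qed.

Lemma based_equiv_sym : symmetric based_equiv.
Proof.
move=> b c; rewrite -[b]based_pathK -[c]based_pathK.
by apply/based_equivP/based_equivP; exact: path_homotopic_sym.
Qed.

Lemma based_equiv_trans : transitive based_equiv.
Proof.
move=> b c d; rewrite -[b]based_pathK -[c]based_pathK -[d]based_pathK.
move=> /based_equivP cb /based_equivP bd; apply/based_equivP.
exact: path_homotopic_trans cb bd.
Qed.

Canonical based_equiv_equiv := EquivRel based_equiv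
  based_equiv_refl based_equiv_sym based_equiv_trans.

(* The hypothesis [x_free] makes endpoints determine [g] and [s], hence makes
   [orbit_braid_equiv] an equivalence relation on the braids based at [x] and the
   product of classes independent of the representatives, cf. [braid_mulE]. *)
Definition orbit_braid_group : Type := {eq_quot based_equiv_equiv}.
HB.instance Definition _ := Choice.on orbit_braid_group.
HB.instance Definition _ := EqQuotient.on orbit_braid_group.

Definition braid_class (a : orbit_path) : orbit_braid_group :=
  \pi_orbit_braid_group (based_braid a).

Lemma braid_classP a b :
  braid_class a = braid_class b <-> path_homotopic (a : I -> F) b.
Proof.
by split=> [/eqquotP/based_equivP|ab]//; apply/eqquotP/based_equivP.
Qed.

Definition class_path (p : orbit_braid_group) : orbit_path :=
  based_path (repr p).

Lemma class_pathK : cancel class_path braid_class.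
Proof. by move=> p; rewrite /braid_class based_pathK reprK. Qed.

Lemma class_pathP a : path_homotopic (class_path (braid_class a) : I -> F) a.
Proof. by apply/braid_classP; rewrite class_pathK. Qed.

Section Product.
Variables a b : orbit_path.

(* the concatenation of [a] with [g b_s], where [a one = g x_s] *)
Definition orbit_cat : I -> F :=
  path_cat a (fun t => conf_act (op_g a) (op_s a) (b t)).

Lemma orbit_cat_continuous : continuous orbit_cat.
Proof.
apply: path_cat_continuous => //; last by rewrite op1 op0.
exact: comp_continuous (@cop b) (@conf_act_continuous _ _ _ _ _ _).
Qed.

Lemma orbit_cat0 : orbit_cat zero = x.
Proof. by rewrite /orbit_cat path_cat0 op0. Qed.

Lemma orbit_cat1 : orbit_cat one =
  conf_act (fun i => op_g a i * op_g b (op_s a i))%g (op_s a * op_s b)%g x.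
Proof. by rewrite /orbit_cat path_cat1 op1 conf_actM. Qed.

Definition orbit_path_mul : orbit_path :=
  orbit_path_of orbit_cat_continuous orbit_cat0 orbit_cat1.

End Product.

Section Inverse.
Variable a : orbit_path.

Definition orbit_rev : I -> F :=
  fun t => conf_act (act_inv (op_g a) (op_s a)) (op_s a)^-1%g (path_rev a t).

Lemma orbit_rev_continuous : continuous orbit_rev.
Proof.
apply: comp_continuous (@conf_act_continuous _ _ _ _ _ _).
exact: path_rev_continuous.
Qed.

Lemma orbit_rev0 : orbit_rev zero = x.
Proof. by rewrite /orbit_rev path_rev0 op1 conf_actK. Qed.

Lemma orbit_rev1 : orbit_rev one =
  conf_act (act_inv (op_g a) (op_s a)) (op_s a)^-1%g x.
Proof. by rewrite /orbit_rev path_rev1 op0. Qed.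

Definition orbit_path_inv : orbit_path :=
  orbit_path_of orbit_rev_continuous orbit_rev0 orbit_rev1.

End Inverse.

Let cst_cont : continuous (fun _ : I => x).
Proof. exact: const_continuous. Qed.

Definition orbit_path_one : orbit_path :=
  @orbit_path_of (fun=> 1%g) 1%g (fun=> x) cst_cont
    erefl (esym (conf_act1 x)).

Definition braid_mul (p q : orbit_braid_group) : orbit_braid_group :=
  braid_class (orbit_path_mul (class_path p) (class_path q)).

Definition braid_inv (p : orbit_braid_group) : orbit_braid_group :=
  braid_class (orbit_path_inv (class_path p)).

Definition braid_one : orbit_braid_group := braid_class orbit_path_one.

Lemma op_homotopic_end (a b : orbit_path) : path_homotopic (a : I -> F) b ->
  op_g a = op_g b /\ op_s a = op_s b.
Proof.
by move=> /path_homotopic_ends[_]; rewrite !op1 => /conf_act_free.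
Qed.

Let mulE a b : (orbit_path_mul a b : I -> F) =
  path_cat a (fun t => conf_act (op_g a) (op_s a) (b t)).
Proof. by []. Qed.

Let invE a : (orbit_path_inv a : I -> F) =
  fun t => conf_act (act_inv (op_g a) (op_s a)) (op_s a)^-1%g (path_rev a t).
Proof. by []. Qed.

Let oneE : (orbit_path_one : I -> F) = fun=> x.
Proof. by []. Qed.

(* the product formula, for arbitrary representatives *)
Lemma braid_mulE a b :
  braid_mul (braid_class a) (braid_class b) = braid_class (orbit_path_mul a b).
Proof.
apply/braid_classP; have Ha := class_pathP a; have Hb := class_pathP b.
have [ga sa] := op_homotopic_end Ha.
apply: path_cat_homotopic => //; first by rewrite op1 op0.
by rewrite ga sa; apply: path_homotopic_comp => //; exact: conf_act_continuous.
Qed.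

Lemma braid_mulA : associative braid_mul.
Proof.
move=> p q r; rewrite -[p]class_pathK -[q]class_pathK -[r]class_pathK.
move: (class_path p) (class_path q) (class_path r) => a b c.
rewrite !braid_mulE; apply/braid_classP; apply: path_homotopic_sym.
rewrite !mulE [op_g (orbit_path_mul a b)]/= [op_s (orbit_path_mul a b)]/=.
rewrite [X in path_homotopic _ (path_cat _ X)](_ : _ = path_cat
    (fun t => conf_act (op_g a) (op_s a) (b t))
    (fun t => conf_act (fun i => op_g a i * op_g b (op_s a i))%g
                       (op_s a * op_s b)%g (c t))); last first.
  rewrite path_cat_comp; congr path_cat.
  by apply/funext => t; rewrite conf_actM.
apply: path_catA => //.
- exact: comp_continuous (@cop b) (@conf_act_continuous _ _ _ _ _ _).
- exact: comp_continuous (@cop c) (@conf_act_continuous _ _ _ _ _ _).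
- by rewrite op1 op0.
- by rewrite op1 op0 conf_actM.
Qed.

Lemma braid_mul1g : left_id braid_one braid_mul.
Proof.
move=> p; rewrite -[p]class_pathK; move: (class_path p) => a.
rewrite braid_mulE; apply/braid_classP; rewrite mulE oneE.
have -> : (fun t => conf_act (fun=> 1%g) 1%g (a t)) = a.
  by apply/funext => t; rewrite conf_act1.
by have := path_cat1f (@cop a); rewrite op0.
Qed.

Lemma braid_mulg1 : right_id braid_one braid_mul.
Proof.
move=> p; rewrite -[p]class_pathK; move: (class_path p) => a.
rewrite braid_mulE; apply/braid_classP; rewrite mulE oneE.
by have := path_catf1 (@cop a); rewrite op1.
Qed.

Lemma braid_mulVg : left_inverse braid_one braid_inv braid_mul.
Proof.
move=> p; rewrite /braid_inv -[X in braid_mul _ X]class_pathK.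
move: (class_path p) => a.
rewrite braid_mulE; apply/braid_classP; rewrite mulE invE oneE.
have /= H := path_homotopic_comp (@conf_act_continuous _ _ _ _
  (act_inv (op_g a) (op_s a)) (op_s a)^-1%g) (path_catVf (@cop a)).
by rewrite path_cat_comp op1 conf_actK in H.
Qed.

Lemma braid_mulgV : right_inverse braid_one braid_inv braid_mul.
Proof.
move=> p; rewrite /braid_inv -[X in braid_mul X _]class_pathK.
move: (class_path p) => a.
rewrite braid_mulE; apply/braid_classP; rewrite mulE invE oneE.
have -> : (fun t => conf_act (op_g a) (op_s a) (conf_act
    (act_inv (op_g a) (op_s a)) (op_s a)^-1%g (path_rev a t))) = path_rev a.
  by apply/funext => t; rewrite conf_actKV.
by have := path_catfV (@cop a); rewrite op0.
Qed.

HB.instance Definition _ := isGroup.Build orbit_braid_group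
  braid_mulA braid_mul1g braid_mulg1 braid_mulVg braid_mulgV.

Definition pure_orbit_braid (p : orbit_braid_group) : bool :=
  `[< exists a : orbit_path,
      (exists g, (a : I -> F) one = conf_act g 1%g x) /\ braid_class a = p >].

Lemma pure_orbit_braidP (a : orbit_path) :
  (braid_class a \in pure_orbit_braid) = (op_s a == 1%g).
Proof.
apply/asboolP/eqP => [[b [[g bg]] /braid_classP /op_homotopic_end[_ <-]]|sa].
  by move: bg; rewrite op1 => /conf_act_free[].
by exists a; split=> //; exists (op_g a); rewrite op1 sa.
Qed.

Lemma pure_orbit_braid_group_closed : group_closed pure_orbit_braid.
Proof.
split=> [|p q]; first by rewrite [_ \in _]pure_orbit_braidP.
rewrite -[p]class_pathK -[q]class_pathK.
move: (class_path p) (class_path q) => a b.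
rewrite (pure_orbit_braidP a) (pure_orbit_braidP b) => /eqP sa /eqP sb.
change (braid_mul (braid_class a) (braid_inv (braid_class b)) \in
  pure_orbit_braid).
rewrite braid_mulE (pure_orbit_braidP (orbit_path_mul _ _)) /= sa mul1g.
have [_ ->] := op_homotopic_end (class_pathP b).
by rewrite sb invg1.
Qed.

Definition pure_orbit_braid_group : Type :=
  {p : orbit_braid_group | p \in pure_orbit_braid}.
HB.instance Definition _ := SubChoice.on pure_orbit_braid_group.
HB.instance Definition _ := SubChoice_isSubGroup.Build orbit_braid_group
  (mem pure_orbit_braid) pure_orbit_braid_group pure_orbit_braid_group_closed.

End OrbitBraidGroup.

(* Main.v *)
From HB Require Import structures.
Require Import Defs.
From mathcomp Require Import all_boot all_order all_algebra fingroup perm.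
From mathcomp Require Import generic_quotient lra.
From mathcomp Require Import all_classical reals topology normedtype homotopy.

(* For a free action on a Hausdorff space, both projections F_G(M,n) -> F(M/G,n)
   and F_G(M,n) -> F(M/G,n)/Sigma_n are orbit maps of free actions of finite
   groups, namely of G^n and of the wreath product of G by Sigma_n, hence coverings.
   Path lifting and homotopy lifting identify homotopy classes of loops downstairs
   with homotopy classes of paths from x to its fibre. The latter are the orbit
   braids, and in the product of two of them the translation of the second path
   by a group element disappears in the quotient. *)

Set Implicit Arguments.
Unset Strict Implicit.
Unset Printing Implicit Defensive.

Import Order.TTheory GRing.Theory Num.Theory.
Import numFieldNormedType.Exports.

Local Open Scope classical_set_scope.
Local Open Scope ring_scope.
Local Open Scope quotient_scope.

(** * Connectedness and convexity of the unit interval *)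

Section IntervalInduction.
Variable R : realType.
Notation I := (unit_interval R).

(** Pulled back along [clamp], the predicate defines an open and closed subset of the connected real
    line. All lifting arguments use this as a form of induction on the interval. *)
Lemma ui_locally_constant (P : I -> Prop) :
  (forall s, \forall s' \near s, P s' <-> P s) -> P zero -> forall s, P s.
Proof.
move=> loc P0 s; pose A : set R := [set r | P (clamp r)].
have cl r : \forall r' \near r, P (clamp r') <-> P (clamp r).
  exact: (@clamp_continuous R r _ (loc (clamp r))).
have cA : connected [set: R] by apply/connected_intervalP.
have -> : P s = A (ui_val s) by rewrite /A/= clampK.
rewrite (cA A) //.
- by exists 0; rewrite /A/= clamp0.
- exists A; last by rewrite setTI.
  rewrite openE => r Ar; rewrite /interior.
  by apply: filterS (cl r) => r' [_]; apply.
- exists A; last by rewrite setTI.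
  rewrite -[A]setCK closedC openE => r Ar; rewrite /interior.
  by apply: filterS (cl r) => r' [h _] /h.
Qed.

(** The interval carries only the subspace topology, so balls are expressed through [ui_val]; the
    retraction [clamp] transports them from the real line. *)
Lemma ui_nbhs_ball (s : I) (A : set I) : nbhs s A ->
  exists2 e : R, 0 < e & forall t, `|ui_val s - ui_val t| < e -> A t.
Proof.
move=> As; have : nbhs (ui_val s) (clamp @^-1` A).
  by apply: clamp_continuous; rewrite clampK.
move=> /nbhs_ballP[e /= e0 eA]; exists e => // t st.
by rewrite -(clampK t); exact: eA.
Qed.

Lemma ui_ball_nbhs (s0 s1 : I) (e : R) : `|ui_val s0 - ui_val s1| < e ->
  \forall s \near s1, `|ui_val s0 - ui_val s| < e.
Proof.
have c : continuous (fun s : I => `|ui_val s0 - ui_val s|).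
  move=> s.
  exact: (cvg_norm (cvgB (cvg_cst (ui_val s0)) (@ui_val_continuous R s))).
by move=> h; exact: (cvgr_lt _ (c s1)).
Qed.

Lemma ui_min_continuous (s : I) :
  continuous (fun t : I => clamp (Num.min (ui_val t) (ui_val s)) : I).
Proof.
apply: comp_continuous (@clamp_continuous R).
under eq_fun do rewrite minEle.
apply: (paste_continuous (@ui_val_continuous R)) => //.
- exact: ui_val_continuous.
- exact: const_continuous.
Qed.

Lemma ui_max_continuous (s : I) :
  continuous (fun t : I => clamp (Num.max (ui_val t) (ui_val s)) : I).
Proof.
apply: comp_continuous (@clamp_continuous R).
under eq_fun do rewrite maxEle.
apply: (paste_continuous (@ui_val_continuous R)) => //.
- exact: const_continuous.
- exact: ui_val_continuous.
Qed.

(** The affine path from [s1] to [s2]. The clamp never truncates, since the interval is convex. *)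
Definition ui_segment (s1 s2 r : I) : I :=
  clamp (ui_val s1 + ui_val r * (ui_val s2 - ui_val s1)).

Lemma ui_segment_continuous s1 s2 : continuous (ui_segment s1 s2).
Proof.
apply: comp_continuous (@clamp_continuous R) => r.
exact: (cvgD (cvg_cst (ui_val s1))
  (cvgM (@ui_val_continuous R r) (cvg_cst (ui_val s2 - ui_val s1)))).
Qed.

Lemma ui_segment0 s1 s2 : ui_segment s1 s2 zero = s1.
Proof. by rewrite /ui_segment ui_val0 mul0r addr0 clampK. Qed.

Lemma ui_segment1 s1 s2 : ui_segment s1 s2 one = s2.
Proof. by rewrite /ui_segment ui_val1 mul1r addrC subrK clampK. Qed.

Lemma ui_segment_ball (s s1 s2 r : I) (e : R) :
  `|ui_val s - ui_val s1| < e -> `|ui_val s - ui_val s2| < e ->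
  `|ui_val s - ui_val (ui_segment s1 s2 r)| < e.
Proof.
move=> h1 h2; rewrite /ui_segment.
set w := ui_val r * (ui_val s2 - ui_val s1).
(* The product [w] is the only nonlinear term; once it is bounded by the difference of the
   endpoints, linear arithmetic suffices. *)
have w_between : [|| 0 <= w <= ui_val s2 - ui_val s1 |
    ui_val s2 - ui_val s1 <= w <= 0].
  have r0 := ui_val_ge0 r; have r1 := ui_val_le1 r.
  have [s12|s21] := lerP 0 (ui_val s2 - ui_val s1).
    by rewrite mulr_ge0//= ler_piMl.
  by apply/orP; right; apply/andP; split; rewrite /w; nra.
have := (ui_val_ge0 s1, ui_val_le1 s1, ui_val_ge0 s2, ui_val_le1 s2).
move=> [[[s10 s11] s20] s21].
rewrite val_clamp; last by case/orP: w_between => /andP[? ?]; lra.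
move: h1 h2; rewrite !ltr_norml => /andP[? ?] /andP[? ?].
by case/orP: w_between => /andP[? ?]; apply/andP; split; lra.
Qed.

End IntervalInduction.

(** * Path and homotopy lifting for orbit maps of finite free actions *)

Lemma hausdorff_nbhs (X : topologicalType) (x y : X) : hausdorff_space X ->
  x <> y -> exists A B, [/\ nbhs x A, nbhs y B & A `&` B = set0].
Proof.
rewrite open_hausdorff => hX /eqP /hX [AB [/set_mem xA /set_mem yB]].
move=> [oA oB /eqP AB0]; exists AB.1, AB.2.
by split; [exact: open_nbhs_nbhs|exact: open_nbhs_nbhs|].
Qed.

(* The maps [T j] are the elements, possibly with repetitions, of a finite group
   acting freely on [E], with orbit map [q]. *)
Section FiniteCovering.
Variables (R : realType) (E B : topologicalType) (q : E -> B).
Variables (J : finType) (T : J -> E -> E).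
Notation I := (unit_interval R).
Hypothesis E_hausdorff : hausdorff_space E.
Hypothesis q_continuous : continuous q.
Hypothesis q_open : forall e A, nbhs e A -> nbhs (q e) (q @` A).
Hypothesis q_surj : forall b, exists e, q e = b.
Hypothesis T_continuous : forall j, continuous (T j).
Hypothesis T_fiber : forall e e', q e = q e' <-> exists j, e' = T j e.
Hypothesis T_free : forall j e, T j e = e -> forall e', T j e' = e'.

(** For each [j] that moves [e], separate [e] from [T j e]; finiteness of [J] allows intersecting
    these conditions. An index that fixes [e] acts as the identity by [T_free], so it cannot relate
    two distinct points. *)
Lemma q_locally_injective e :
  exists U, [/\ open U, U e & forall u v, U u -> U v -> q u = q v -> u = v].
Proof.
have sep j : exists A B, [/\ nbhs e A, nbhs (T j e) B &
    T j e <> e -> A `&` B = set0].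
  case: (pselect (T j e = e)) => [->|Te].
    by exists setT, setT; split=> //; exact: filterT.
  have [A [C [eA TC AC]]] := hausdorff_nbhs E_hausdorff (nesym Te).
  by exists A, C.
have [A /choice[C AC]] := choice sep.
pose U := [set u | forall j, A j u /\ C j (T j u)].
have eU : nbhs e U.
  apply: filter_forall => j; have [eA TC _] := AC j.
  by apply: filterI => //; exact: T_continuous.
exists U°; split; [exact: open_interior|by []|].
move=> u v /interior_subset uU /interior_subset vU /T_fiber[j jv].
have [_ _ dis] := AC j; have [Te|Te] := pselect (T j e = e).
  by rewrite jv (T_free Te).
have : (A j `&` C j) v by split; [have [] := vU j|rewrite jv; have [] := uU j].
by rewrite dis.
Qed.

(** The section inverts [q] on a set where [q] is injective, and openness of [q] makes this inverse
    continuous. *)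
Lemma local_section e : exists (U : set E) (s : B -> E), [/\ open U, U e,
  forall u, U u -> s (q u) = u & forall u, U u -> {for q u, continuous s}].
Proof.
have [U [oU Ue inj]] := q_locally_injective e.
(* Off the image of [U] the value of [s] is unconstrained; [e] only shows that some value exists. *)
have /choice[s sP] : forall b, exists u, (q @` U) b -> U u /\ q u = b.
  by move=> b; have [[u Uu ub]|nb] := pselect ((q @` U) b); [exists u|exists e].
have sq u : U u -> s (q u) = u.
  by move=> Uu; have [|? ?] := sP (q u); [exists u|exact: inj].
exists U, s; split=> // u Uu N; rewrite sq// => uN.
have : nbhs (q u) (q @` (N `&` U)).
  by apply: q_open; apply: filterI => //; exact: open_nbhs_nbhs.
apply: filterS => _ [v [Nv Uv] <-].
by rewrite /= sq.
Qed.

(** The set where the lifts agree is open by local injectivity of [q], and its complement is open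
    because [E] is Hausdorff. *)
Lemma lift_unique (f g : I -> E) : continuous f -> continuous g ->
  (forall t, q (f t) = q (g t)) -> f zero = g zero -> f = g.
Proof.
move=> cf cg fg fg0; apply/funext; apply: ui_locally_constant => // s.
have [fgs|fgs] := pselect (f s = g s).
  have [U [oU Ue inj]] := q_locally_injective (f s).
  have Uf : nbhs s (f @^-1` U) by apply: cf; exact: open_nbhs_nbhs.
  have Ug : nbhs s (g @^-1` U) by apply: cg; rewrite -fgs; exact: open_nbhs_nbhs.
  by apply: filterS (filterI Uf Ug) => t [? ?]; split=> // _; exact: inj.
have [A [C [fA gC AC]]] := hausdorff_nbhs E_hausdorff fgs.
have sA : nbhs s (f @^-1` A) by exact: cf.
have sC : nbhs s (g @^-1` C) by exact: cg.
apply: filterS (filterI sA sC) => t [/= At Ct].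
split=> // fgt; have : (A `&` C) (f t) by split; rewrite // fgt.
by rewrite AC.
Qed.

Lemma path_lift (f : I -> B) e : continuous f -> q e = f zero ->
  exists g : I -> E, [/\ continuous g, g zero = e & forall t, q (g t) = f t].
Proof.
(* Composing with [m s] freezes a path after time [s], so [P s] says that [f] lifts up to time [s]
   while all paths keep the domain [I]. *)
move=> cf ef; pose m (s t : I) : I := clamp (Num.min (ui_val t) (ui_val s)).
pose P s := exists g : I -> E,
  [/\ continuous g, g zero = e & forall t, q (g t) = f (m s t)].
suff /(_ one) [g [cg g0 gf]] : forall s, P s.
  exists g; split=> // t; rewrite gf /m ui_val1 min_l ?clampK//.
  exact: ui_val_le1.
have m0 s : m s zero = zero.
  by rewrite /m ui_val0 min_l ?ui_val_ge0// clamp0.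
have val_m s t : ui_val (m s t) = Num.min (ui_val t) (ui_val s).
  rewrite /m val_clamp// le_min !ui_val_ge0/=.
  by rewrite ge_min ui_val_le1.
have mm s s' t : ui_val s <= ui_val s' -> m s' (m s t) = m s t.
  move=> ss'; rewrite /m -/(m s t) val_m min_l// ge_min.
  by rewrite ss' orbT.
apply: ui_locally_constant; last first.
  exists (fun=> e); split=> [|//|t]; first exact: const_continuous.
  by rewrite /m ui_val0 min_r ?ui_val_ge0// clamp0.
move=> s0; have [e0 e0f] := q_surj (f s0).
have [U [s [oU Ue sq cs]]] := local_section e0.
have : nbhs s0 (f @^-1` (q @` U)).
  by apply: cf; rewrite -e0f; apply: q_open; exact: open_nbhs_nbhs.
move=> /ui_nbhs_ball[d d0 dU].
(* Over the ball of radius [d] the path [f] stays in the domain of one local section. The claim is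
   symmetric in [s1] and [s2], which gives the equivalence that local constancy needs. *)
suff step s1 s2 : `|ui_val s0 - ui_val s1| < d ->
    `|ui_val s0 - ui_val s2| < d -> P s1 -> P s2.
  have h0 : `|ui_val s0 - ui_val s0| < d by rewrite subrr normr0.
  by apply: filterS (ui_ball_nbhs h0) => s1 h1; split; exact: step.
move=> h1 h2 [g [cg g0 gf]].
have [s21|/ltW s12] := lerP (ui_val s2) (ui_val s1).
  exists (fun t => g (m s2 t)); split=> [|//|t]; last by rewrite gf mm.
  - have cm : continuous (m s2) by exact: ui_min_continuous.
    exact: comp_continuous cm cg.
  - by rewrite m0.
(* Confining time to the span from [s1] to [s2] keeps the section within its domain for every [t],
   so that the second branch of the pasted path is continuous on all of [I]. *)
pose c (t : I) : I := clamp (Num.max (ui_val (m s2 t)) (ui_val s1)).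
have val_c t : ui_val (c t) = Num.max (ui_val (m s2 t)) (ui_val s1).
  by rewrite /c val_clamp// le_max !ui_val_ge0/= ge_max !ui_val_le1.
have c_ball t : `|ui_val s0 - ui_val (c t)| < d.
  rewrite val_c val_m; move: h1 h2; rewrite !ltr_norml => /andP[? ?] /andP[? ?].
  case: (lerP (ui_val t) (ui_val s2)) => ts2.
    by case: (lerP (ui_val t) (ui_val s1)) => ts1; apply/andP; split; lra.
  by rewrite max_l//; apply/andP; split.
have sE b : (q @` U) b -> q (s b) = b by move=> [u /sq su <-]; rewrite su.
(* The section may lie on another sheet than [g]; the translation [T j] makes the two match at
   [s1]. *)
have [j gs1] : exists j, g s1 = T j (s (f s1)).
  apply/T_fiber; rewrite sE; last exact: dU.
  by rewrite gf /m min_l// clampK.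
exists (fun t => if ui_val t <= ui_val s1 then g t else T j (s (f (c t)))).
split.
- apply: (paste_continuous (@ui_val_continuous R) cg).
    suff csfc : continuous (fun t => s (f (c t))).
      exact: comp_continuous csfc (@T_continuous j).
    move=> t; have [u Uu uf] : (q @` U) (f (c t)) by exact: dU.
    apply: (@continuous_comp _ _ _ (fun t => f (c t)) s).
      have cc : continuous c.
        exact: comp_continuous (@ui_min_continuous _ s2) (@ui_max_continuous _ s1).
      exact: (comp_continuous cc cf).
    by rewrite -uf; exact: cs.
  move=> t ts1; have -> : t = s1 by exact: ui_val_inj.
  by rewrite gs1 /c val_m min_l// maxxx clampK.
- by rewrite ui_val0 ui_val_ge0.
- move=> t; case: ifPn => ts1.
    by rewrite gf /m !min_l// (le_trans ts1).
  have -> : q (T j (s (f (c t)))) = q (s (f (c t))).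
    by apply/esym/T_fiber; exists j.
  rewrite sE; last exact: dU.
  congr f; apply: ui_val_inj; rewrite val_c val_m max_l//.
  by rewrite le_min s12 andbT ltW// ltNge.
Qed.

(* The set of [s] such that [t |-> K (s, t)] is continuous at [t0] is open and
   closed: near [(s0, t0)] the map [K] agrees with a local section of [q] composed
   with [q K], as soon as it does for a single value of [s]. *)
Lemma lift_continuous (K : I * I -> E) : continuous (fun st => q (K st)) ->
  (forall t, continuous (fun s => K (s, t))) ->
  continuous (fun t => K (zero, t)) -> continuous K.
Proof.
move=> cqK cK1 cK0 [s0 t0]; move: s0.
have step s0 : exists2 d : R, 0 < d & forall s1 s2,
    `|ui_val s0 - ui_val s1| < d -> `|ui_val s0 - ui_val s2| < d ->
    {for t0, continuous (fun t => K (s1, t))} -> {for (s2, t0), continuous K}.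
  have [U [s [oU Ue sq cs]]] := local_section (K (s0, t0)).
  have : nbhs (s0, t0) ((fun st => q (K st)) @^-1` (q @` U)).
    by apply: cqK; apply: q_open; exact: open_nbhs_nbhs.
  move=> [[A1 A2] /= [/ui_nbhs_ball[d d0 dA1] nA2] A12].
  have qU s1 t : `|ui_val s0 - ui_val s1| < d -> A2 t -> (q @` U) (q (K (s1, t))).
    by move=> /dA1 ? ?; exact: A12.
  have sE b : (q @` U) b -> q (s b) = b by move=> [u /sq su <-]; rewrite su.
  have cs' b : (q @` U) b -> {for b, continuous s} by move=> [u /cs su <-].
  (* Along the segment from [s1] to [s2], both [s (q K)] and [K] lift the same path, so agreement at
     one end forces agreement at the other. *)
  have along s1 s2 t : `|ui_val s0 - ui_val s1| < d ->
      `|ui_val s0 - ui_val s2| < d -> A2 t ->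
      s (q (K (s1, t))) = K (s1, t) -> s (q (K (s2, t))) = K (s2, t).
    move=> h1 h2 A2t E1; pose c := ui_segment s1 s2.
    have hc r : `|ui_val s0 - ui_val (c r)| < d by exact: ui_segment_ball.
    rewrite -(ui_segment1 s1 s2) -/c.
    have cKc : continuous (fun r => K (c r, t)).
      exact: comp_continuous (@ui_segment_continuous _ s1 s2) (cK1 t).
    pose sK r := s (q (K (c r, t))).
    suff sKE : sK = (fun r => K (c r, t)).
      exact: (congr1 (fun h => h one) sKE).
    apply: lift_unique => //.
    - move=> r; apply: (@continuous_comp _ _ _ (fun r => q (K (c r, t))) s).
        exact: (comp_continuous cKc q_continuous).
      by apply: cs'; exact: qU.
    - by move=> r; rewrite /sK sE//; exact: qU.
    - by rewrite /sK /c ui_segment0.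
  have A2t0 : A2 t0 by exact: nbhs_singleton.
  have h0 : `|ui_val s0 - ui_val s0| < d by rewrite subrr normr0.
  exists d => // s1 s2 h1 h2 cs1.
  have U1 : U (K (s1, t0)).
    have [u Uu uK] := qU _ _ h1 A2t0.
    have <- : s (q (K (s1, t0))) = K (s1, t0) by apply: (along s0); rewrite ?sq.
    by rewrite -uK sq.
  have near_t : \forall t \near t0, A2 t /\ U (K (s1, t)).
    by apply: filterI => //; apply: cs1; exact: open_nbhs_nbhs.
  (* For [t] near [t0] the point [K (s1, t)] lies in [U], where [s] inverts [q]; [along] carries
     this to every [s'] in the ball, which yields a whole box. *)
  have sqK : \forall st \near (s2, t0), s (q (K st)) = K st.
    exists ([set s' | `|ui_val s0 - ui_val s'| < d],
            [set t | A2 t /\ U (K (s1, t))]).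
      by split=> //=; exact: ui_ball_nbhs.
    move=> [s' t] [/= h' [A2t Ut]]; apply: (along s1) => //.
    by rewrite sq.
  have sqK2 : s (q (K (s2, t0))) = K (s2, t0) := nbhs_singleton sqK.
  apply: cvg_trans (near_eq_cvg sqK) _; rewrite -sqK2.
  apply: (@continuous_comp _ _ _ (fun st => q (K st)) s); first exact: cqK.
  by apply: cs'; exact: qU.
have h0 s0 (d : R) : 0 < d -> `|ui_val s0 - ui_val s0| < d.
  by rewrite subrr normr0.
have K_at s : {for (s, t0), continuous K} ->
    {for t0, continuous (fun t => K (s, t))}.
  move=> cK; apply: (@continuous_comp _ _ _ (fun t => (s, t)) K) => //.
  exact: (pair_continuous (@const_continuous _ _ s) (fun=> cvg_id)).
move=> s0; have [d d0 /(_ s0 s0)] := step s0.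
apply; [exact: h0|exact: h0|].
move: s0 {d d0}; apply: ui_locally_constant; last exact: cK0.
move=> s0; have [d d0 H] := step s0.
apply: filterS (ui_ball_nbhs (h0 s0 _ d0)) => s1 h1.
by split=> h; apply: K_at; apply: H h => //; exact: h0.
Qed.

(** Each slice of the homotopy at a fixed [t] is lifted from the common starting point. The left
    edge is then constant, which yields joint continuity, and uniqueness of lifts identifies the
    other three edges. *)
Lemma path_homotopic_lift (a b : I -> E) : continuous a -> continuous b ->
  a zero = b zero ->
  path_homotopic (fun t => q (a t)) (fun t => q (b t)) -> path_homotopic a b.
Proof.
move=> ca cb ab [H [cH H0 H1 Hz Ho]].
have /choice[K KP] : forall t, exists g : I -> E,
    [/\ continuous g, g zero = a zero & forall s, q (g s) = H (s, t)].
  move=> t; apply: path_lift; last by rewrite Hz.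
  apply: comp_continuous cH; apply: pair_continuous => //.
    by move=> ?; exact: cvg_id.
  exact: const_continuous.
have Kq s t : q (K t s) = H (s, t) by have [_ _] := KP t.
have Kz t : K t zero = a zero by have [_ ->] := KP t.
have Kc t : continuous (K t) by have [] := KP t.
have cK : continuous (fun st : I * I => K st.2 st.1).
  apply: lift_continuous => //=.
    by rewrite (_ : (fun st => _) = H)//; apply/funext => -[s t]; rewrite Kq.
  rewrite (_ : (fun t => _) = fun=> a zero); first exact: const_continuous.
  by apply/funext => t; rewrite Kz.
have K0 : K zero = a by apply: lift_unique => // t; rewrite Kq H0.
exists (fun st => K st.2 st.1); split=> //= [s|s|t].
- by rewrite K0.
- by rewrite (_ : K one = b)//; apply: lift_unique => // [t|]; rewrite ?Kq ?H1 ?Kz.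
(* The right edge lifts a constant path and starts at [a one]. *)
- suff Ko1 : (fun t => K t one) = (fun=> a one).
    exact: (congr1 (fun h => h t) Ko1).
  have one_id : continuous (fun t : I => (one : I, t)).
    exact: (pair_continuous (@const_continuous _ _ one) (fun=> cvg_id)).
  apply: lift_unique => [| |t'|]; rewrite ?Kq ?Ho ?K0//.
  + exact: (comp_continuous one_id cK).
  + exact: const_continuous.
Qed.

End FiniteCovering.

(** * Open quotient maps and boxes in products *)

(** The saturation of an open set is the union of its preimages under the maps [T j], hence open. *)
Lemma quotient_map_open (X : topologicalType) (Q0 : quotType X) (J : Type)
    (T : J -> X -> X) (Q := quotient_topology Q0) :
  (forall j, continuous (T j)) ->
  (forall u v, \pi_Q u = \pi_Q v <-> exists j, v = T j u) ->
  forall (u : X) (A : set X), nbhs u A ->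
    nbhs (\pi_Q u : Q) ((\pi_Q : X -> Q) @` A).
Proof.
move=> cT fiber u A uA.
suff : nbhs (\pi_Q u : Q) ((\pi_Q : X -> Q) @` A°).
  by apply: filterS => _ [v Av <-]; exists v => //; exact: interior_subset.
apply: open_nbhs_nbhs; split; last by exists u.
rewrite /open/= /quotient_open.
rewrite (_ : _ @^-1` _ = \bigcup_j (T j @^-1` A°)).
  apply: bigcup_open => j _; apply: open_comp; last exact: open_interior.
  by move=> ? _; exact: cT.
apply/seteqP; split=> [w [v Av /esym /fiber[j vj]]|w [j _ Aj]].
  by exists j => //=; rewrite -vj.
by exists (T j w) => //; apply/esym/fiber; exists j.
Qed.

Section PtwsBox.
Variables (J : finType) (X : topologicalType).

(** The sets that contain a box around [y] form a filter, so its convergence to [y] can be tested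
    one coordinate at a time, with boxes that restrict only that coordinate. *)
Lemma nbhs_ptws_box (y : {ptws J -> X}) (A : set {ptws J -> X}) : nbhs y A ->
  exists C : J -> set X, (forall j, nbhs (y j) (C j)) /\
    forall z, (forall j, C j (z j)) -> A z.
Proof.
pose F : set_system {ptws J -> X} := fun A => exists C : J -> set X,
  (forall j, nbhs (y j) (C j)) /\ forall z, (forall j, C j (z j)) -> A z.
have FF : Filter F.
  split=> [|P Q [C [yC CP]] [D [yD DQ]]|P Q PQ [C [yC CP]]].
  - by exists (fun=> setT); split=> // j; exact: filterT.
  - exists (fun j => C j `&` D j); split=> [j|z zCD]; first exact: filterI.
    by split; [apply: CP => j|apply: DQ => j]; have [] := zCD j.
  - by exists C; split=> // z /CP /PQ.
suff : F --> y by apply.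
apply/cvg_sup => j B [_ [[O oO <-] Oy OB]].
exists (fun k => if k == j then O else setT); split=> [k|z zO].
  by case: eqP => [->|_]; [exact: open_nbhs_nbhs|exact: filterT].
by apply: OB => /=; have := zO j; rewrite eqxx.
Qed.

End PtwsBox.

(** * The projection onto ordered configurations of the orbit space *)

Section OrbitConfCovering.
Variables (G : finGroupType) (M : topologicalType) (act : gaction G M).
Variable n : nat.
Notation F := (orbit_conf act n).

Lemma orbit_proj_eq p p' :
  orbit_proj act p = orbit_proj act p' <-> exists g, p' = act g p.
Proof.
split=> [/eqquotP /asboolP[g _ <-]|[g ->]]; first by exists g.
by apply/eqquotP/asboolP; exists g.
Qed.

Lemma orbit_proj_open p A : nbhs p A ->
  nbhs (orbit_proj act p) (orbit_proj act @` A).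
Proof.
exact: (quotient_map_open (@gact_continuous _ _ act) orbit_proj_eq).
Qed.

Lemma unordered_proj_eq (X : topologicalType) (y z : conf X n) :
  unordered_proj y = unordered_proj z <-> exists s, z = conf_perm s y.
Proof. by split=> [/eqquotP /asboolP|yz] //; apply/eqquotP/asboolP. Qed.

Lemma conf_perm_continuous (X : topologicalType) (s : 'S_n) :
  continuous (@conf_perm X n s).
Proof.
apply: continuous_comp_initial; apply: ptws_continuous => i.
apply: (@comp_continuous _ _ _ (fun y : conf X n => set_val y)
  (fun y => y (s i))); first exact: initial_continuous.
exact: ptws_proj_continuous.
Qed.

Lemma unordered_proj_open (X : topologicalType) (y : conf X n) A : nbhs y A ->
  nbhs (unordered_proj y) ((@unordered_proj X n) @` A).
Proof.
exact: (quotient_map_open (@conf_perm_continuous X) (@unordered_proj_eq X)).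
Qed.

Lemma set_val_coord_continuous (X : topologicalType) (A : set {ptws 'I_n -> X})
  (i : 'I_n) : continuous (fun y : A => (set_val y : {ptws 'I_n -> X}) i).
Proof.
apply: (@comp_continuous _ _ _ (fun y : A => set_val y) (fun y => y i)).
  exact: initial_continuous.
exact: ptws_proj_continuous.
Qed.

Lemma orbit_conf_hausdorff : hausdorff_space M -> hausdorff_space F.
Proof.
move=> hM y z yz; apply: val_inj; apply/funext => i; apply: hM => A C yA zC.
have cF := @set_val_coord_continuous _ (orbit_conf act n) i.
by have [w [Aw Cw]] := yz _ _ (cF y _ yA) (cF z _ zC); exists (set_val w i).
Qed.

Lemma orbit_proj_conf_continuous : continuous (@orbit_proj_conf _ _ act n).
Proof.
apply: continuous_comp_initial; apply: ptws_continuous => i.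
exact: comp_continuous (@set_val_coord_continuous _ _ i) (@pi_continuous _ _).
Qed.

Lemma conf_actE g s (y : F) i :
  set_val (conf_act g s y) i = act (g i) (set_val y (s i)).
Proof. by []. Qed.

(** The group elements are collected in a finite function because the covering results take a finite
    index type. *)
Lemma orbit_proj_conf_eq (y z : F) :
  orbit_proj_conf y = orbit_proj_conf z <->
  exists g : {ffun 'I_n -> G}, z = conf_act g 1%g y.
Proof.
split=> [yz|[g ->]]; last first.
  apply: val_inj; apply/funext => i /=; apply/orbit_proj_eq.
  by exists (g i); rewrite conf_actE perm1.
have /choice[g gP] : forall i, exists g, set_val z i = act g (set_val y i).
  move=> i; apply/orbit_proj_eq.
  by rewrite -[LHS]/(set_val (orbit_proj_conf y) i) yz.
exists (finfun g); apply: val_inj; apply/funext => i /=.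
by rewrite ffunE perm1 -gP.
Qed.

(** Coordinates may be lifted independently: a common point of two orbits would identify two
    coordinates of [w]. Surjectivity and openness both rest on this. *)
Lemma orbit_proj_conf_lift (w : conf (orbit_space act) n) (z : 'I_n -> M) :
  (forall i, orbit_proj act (z i) = set_val w i) ->
  exists2 y : F, set_val y = z & orbit_proj_conf y = w.
Proof.
move=> zw; have zF : (z : {ptws 'I_n -> M}) \in F.
  apply/mem_set => i j ij; rewrite -subset0 => p [[g _ gp] [h _ hp]].
  suff wij : set_val w i = set_val w j by exact: (set_valP w i j ij wij).
  rewrite -!zw; apply/orbit_proj_eq.
  by exists (h^-1 * g)%g; rewrite gactM gp -hp gactK.
by exists (SigSub zF) => //; apply: val_inj; apply/funext => i /=; exact: zw.
Qed.

Lemma orbit_proj_conf_surj w : exists y : F, orbit_proj_conf y = w.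
Proof.
have /choice[z zw] : forall i, exists p, orbit_proj act p = set_val w i.
  by move=> i; exists (repr (set_val w i)); exact: reprK.
by have [y _ yw] := orbit_proj_conf_lift zw; exists y.
Qed.

(** Inside the given neighbourhood choose a box. Its sides have neighbourhoods as images in the
    orbit space, and a configuration near the image of [y] lifts coordinatewise into the box. *)
Lemma orbit_proj_conf_open (y : F) A : nbhs y A ->
  nbhs (orbit_proj_conf y) ((@orbit_proj_conf _ _ act n) @` A).
Proof.
move=> [_ [[O oO <-] /= Oy OA]].
have /nbhs_ptws_box[C [yC CO]] : nbhs (set_val y) O by exact: open_nbhs_nbhs.
have Cnear i : \forall w \near orbit_proj_conf y,
    (orbit_proj act @` C i) (set_val w i).
  have ci := @set_val_coord_continuous _ (conf (orbit_space act) n) i.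
  by apply: (ci (orbit_proj_conf y)); apply: orbit_proj_open; exact: yC.
have := @filter_forall _ _
  (fun i (w : conf (orbit_space act) n) => (orbit_proj act @` C i) (set_val w i))
  (nbhs (orbit_proj_conf y)) (nbhs_filter _) Cnear.
apply: filterS => w wC.
have /choice[z zP] : forall i, exists p, C i p /\ orbit_proj act p = set_val w i.
  by move=> i; have [p ? ?] := wC i; exists p.
have [v vz vw] := orbit_proj_conf_lift (fun i => (zP i).2).
by exists v => //; apply/OA/CO => i; rewrite vz; exact: (zP i).1.
Qed.

End OrbitConfCovering.

(** * The projection onto unordered configurations of the orbit space *)

Section UnorderedOrbitProjection.
Variables (G : finGroupType) (M : topologicalType) (act : gaction G M).
Variable n : nat.
Notation F := (orbit_conf act n).

Definition unordered_orbit_proj (y : F) : unordered_conf (orbit_space act) n :=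
  unordered_proj (orbit_proj_conf y).

Lemma unordered_orbit_proj_continuous : continuous unordered_orbit_proj.
Proof.
exact: comp_continuous (@orbit_proj_conf_continuous _ _ act n)
  (@pi_continuous _ _).
Qed.

Lemma unordered_orbit_proj_open (y : F) A : nbhs y A ->
  nbhs (unordered_orbit_proj y) (unordered_orbit_proj @` A).
Proof.
move=> /orbit_proj_conf_open /unordered_proj_open.
by rewrite image_comp.
Qed.

Lemma unordered_orbit_proj_surj w : exists y : F, unordered_orbit_proj y = w.
Proof.
have [y yw] := orbit_proj_conf_surj (repr w : conf (orbit_space act) n).
by exists y; rewrite /unordered_orbit_proj yw; exact: reprK.
Qed.

(** A permutation downstairs lifts to the same permutation upstairs with trivial group part; the
    remaining ambiguity lies in the fibre of [orbit_proj_conf]. *)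
Lemma unordered_orbit_proj_eq (y z : F) :
  unordered_orbit_proj y = unordered_orbit_proj z <->
  exists gs : {ffun 'I_n -> G} * 'S_n, z = conf_act gs.1 gs.2 y.
Proof.
have perm_proj s : conf_perm s (orbit_proj_conf y) =
    orbit_proj_conf (conf_act (fun=> 1%g) s y).
  apply: val_inj; apply/funext => i /=; apply/orbit_proj_eq.
  by exists 1%g; rewrite conf_actE gact1.
split=> [/unordered_proj_eq[s]|[[g s] ->]].
  rewrite perm_proj => /esym /orbit_proj_conf_eq[g ->].
  exists (g, s); rewrite conf_actM mul1g; congr conf_act.
  by apply/funext => i; rewrite mulg1.
apply/unordered_proj_eq; exists s; rewrite perm_proj; apply/esym.
apply/orbit_proj_conf_eq; exists g; rewrite conf_actM mul1g; congr conf_act.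
by apply/funext => i; rewrite mulg1.
Qed.

(** Under a free action every configuration has coordinates with orbits of free type, so
    [conf_act_free] is available at [y] and not only at the base point. *)
Lemma conf_act_fix (act_free : free_action act) g s (y : F) :
  conf_act g s y = y -> g = (fun=> 1%g) /\ s = 1%g.
Proof.
rewrite -{2}[y]conf_act1; apply: conf_act_free => i p _ h.
exact: act_free.
Qed.

End UnorderedOrbitProjection.

(** * From orbit braids to loops in the quotient *)

Lemma group_isomorphic_morph (A B : groupType) (f : A -> B) :
  {morph f : a b / (a * b)%g} -> injective f -> (forall b, exists a, f a = b) ->
  group_isomorphic A B.
Proof.
move=> fM f_inj /choice[h fh].
pose fm := isMultiplicative.Build A B f fM.
pose F : {multiplicative A -> B} := HB.pack f fm.
by exists F; exists h => [a|b]; [apply: f_inj; exact: fh|exact: fh].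
Qed.

Section BraidProjection.
Variables (R : realType) (G : finGroupType) (M : topologicalType).
Variables (act : gaction G M) (n : nat) (x : orbit_conf act n).
Variable x_free : forall i, free_type_orbit act (gorbit act (set_val x i)).
Notation I := (unit_interval R).
Notation F := (orbit_conf act n).
Notation class_path := (@class_path R G M act n x x_free).
Notation braid_class := (@braid_class R G M act n x x_free).
(** Abstracting [q] and [v] treats both isomorphisms at once: [v] will be the inclusion of the pure
    subgroup or the identity. By [v_fiber] and [v_onto], its image consists of the classes whose
    paths become loops under [q]. *)
Variables (B : topologicalType) (q : F -> B).
Variables (A : groupType) (v : {multiplicative A -> orbit_braid_group R x_free}).
Hypothesis q_continuous : continuous q.
Hypothesis v_inj : injective v.
Hypothesis v_fiber : forall p y,
  q (conf_act (op_g (class_path (v p))) (op_s (class_path (v p))) y) = q y.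
Hypothesis v_onto : forall a : orbit_path R x,
  q ((a : I -> F) one) = q x -> exists p, v p = braid_class a.
Hypothesis q_orbit : forall y, q y = q x -> base_orbit x y.
Hypothesis q_path_lift : forall f : I -> B, continuous f -> q x = f zero ->
  exists g : I -> F, [/\ continuous g, g zero = x & forall t, q (g t) = f t].
Hypothesis q_homotopy_lift : forall a b : I -> F,
  continuous a -> continuous b -> a zero = b zero ->
  path_homotopic (fun t => q (a t)) (fun t => q (b t)) -> path_homotopic a b.

Let cop (a : orbit_path R x) : continuous (a : I -> F).
Proof. exact: cts_fun. Qed.

Let op0 (a : orbit_path R x) : (a : I -> F) zero = x.
Proof. exact: path_zero. Qed.

Let op1 (a : orbit_path R x) : (a : I -> F) one = conf_act (op_g a) (op_s a) x.
Proof. exact: path_one. Qed.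

Let proj_continuous p : continuous (fun t => q ((class_path (v p) : I -> F) t)).
Proof. exact: (comp_continuous (@cop _) q_continuous). Qed.

Let proj0 p : q ((class_path (v p) : I -> F) zero) = q x.
Proof. by rewrite op0. Qed.

Let proj1 p : q ((class_path (v p) : I -> F) one) = q x.
Proof. by rewrite op1 v_fiber. Qed.

Definition projected_loop p : {path I from q x to q x in B} :=
  mk_path (@proj_continuous p) (proj0 p) (proj1 p).

Definition braid_projection (p : A) : pi1 R (q x) :=
  \pi_(pi1 R (q x)) (projected_loop p).

Lemma braid_projectionM : {morph braid_projection : p r / (p * r)%g}.
Proof.
move=> p r; rewrite [RHS]pi1_mulE; apply/pi1_eqP.
have vM : v (p * r)%g =
    braid_class (orbit_path_mul (class_path (v p)) (class_path (v r))).
  by rewrite gmulfM.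
have H : path_homotopic (class_path (v (p * r)%g) : I -> F)
    (orbit_path_mul (class_path (v p)) (class_path (v r))).
  by rewrite vM; exact: class_pathP.
have := path_homotopic_comp q_continuous H.
congr path_homotopic; rewrite -[LHS]/(fun t => q (orbit_cat _ _ t)).
rewrite path_cat_comp; congr path_cat.
(* The translation of the second path, built into [orbit_cat], is invisible to [q]. *)
by apply/funext => t; exact: v_fiber.
Qed.

(** The representatives start at the same point [x], so a homotopy of the projected loops lifts to
    one between them. *)
Lemma braid_projection_inj : injective braid_projection.
Proof.
move=> p r /pi1_eqP H; apply: v_inj.
rewrite -[v p](class_pathK) -[v r]class_pathK; apply/braid_classP.
by apply: q_homotopy_lift => //; rewrite !op0.
Qed.

Lemma braid_projection_surj c : exists p, braid_projection p = c.
Proof.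
have f0 : q x = (repr c : I -> B) zero by rewrite path_zero.
have [g [cg g0 gq]] := q_path_lift (@cts_fun _ _ (repr c)) f0.
have qg1 : q (g one) = q x by rewrite gq; exact: path_one.
(* The lift of the loop ends over [q x], hence in the orbit of [x]; this makes it an orbit path. *)
have [h [s g1]] := q_orbit qg1.
pose a : orbit_path R x := orbit_path_of cg g0 g1.
have [p vp] := v_onto (a := a) qg1.
exists p; rewrite -[c]reprK; apply/pi1_eqP.
have -> : (repr c : I -> B) = fun t => q (g t).
  by apply/funext => t; rewrite gq.
apply: (path_homotopic_comp q_continuous).
rewrite -[g]/(a : I -> F).
by rewrite vp; exact: class_pathP.
Qed.

Lemma braid_projection_isomorphic : group_isomorphic A (pi1 R (q x)).
Proof.
exact: group_isomorphic_morph braid_projectionM braid_projection_inj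
  braid_projection_surj.
Qed.

End BraidProjection.

Theorem corollary4 (R : realType) (M : topologicalType) (d : nat)
    (G : finGroupType) (act : gaction G M) (n : nat) (x : orbit_conf act n)
    (M_manifold : topological_manifold R d M)
    (M_connected : connected [set: M])
    (d_ge2 : (2 <= d)%N)
    (act_effective : effective_action act)
    (n_ge2 : (2 <= n)%N)
    (x_free : forall i, free_type_orbit act (gorbit act (set_val x i)))
    (act_free : free_action act) :
  group_isomorphic (pure_orbit_braid_group R x_free)
    (pure_braid_group R (orbit_proj_conf x)) /\
  group_isomorphic (orbit_braid_group R x_free)
    (braid_group R (orbit_proj_conf x)).
Proof.
have F_hausdorff : hausdorff_space (orbit_conf act n).
  by case: M_manifold => hM _ _; exact: orbit_conf_hausdorff.
split.
(* The covering group is the power of [G], acting without permutation. *)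
- pose T (g : {ffun 'I_n -> G}) := @conf_act _ _ act n g 1%g.
  have T_continuous g : continuous (T g) by exact: conf_act_continuous.
  have T_free g y : T g y = y -> forall y', T g y' = y'.
    by rewrite /T => /(conf_act_fix act_free)[-> _] y'; exact: conf_act1.
  apply: (@braid_projection_isomorphic _ _ _ _ _ _ _ _
    (@orbit_proj_conf _ _ act n) (pure_orbit_braid_group R x_free) val).
  + exact: orbit_proj_conf_continuous.
  + exact: val_inj.
  (* Purity forces the permutation of the chosen representative to be trivial, so its endpoint
     transformation preserves the fibres. *)
  + move=> p y; apply/esym/orbit_proj_conf_eq.
    have := valP p; rewrite -{1}[val p]class_pathK pure_orbit_braidP => /eqP ->.
    exists (finfun (op_g (class_path (val p)))); congr conf_act.
    by apply/funext => i; rewrite ffunE.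
  + move=> a /esym /orbit_proj_conf_eq[g ag].
    have pa : braid_class x_free a \in @pure_orbit_braid R _ _ _ _ _ x_free.
      by apply/asboolP; exists a; split=> //; exists g.
    by exists (Sub (braid_class x_free a) pa); exact: SubK.
  + by move=> y /esym /orbit_proj_conf_eq[g ->]; exists g, 1%g.
  + move=> f; exact: (path_lift F_hausdorff (@orbit_proj_conf_open _ _ act n)
      (@orbit_proj_conf_surj _ _ act n) T_continuous
      (@orbit_proj_conf_eq _ _ act n) T_free).
  + move=> a b; exact: (path_homotopic_lift F_hausdorff
      (@orbit_proj_conf_continuous _ _ act n)
      (@orbit_proj_conf_open _ _ act n) (@orbit_proj_conf_surj _ _ act n)
      T_continuous (@orbit_proj_conf_eq _ _ act n) T_free).
(* The pairs index the elements of the wreath product; only its action on configurations enters, not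
   its multiplication. *)
- pose T (gs : {ffun 'I_n -> G} * 'S_n) := @conf_act _ _ act n gs.1 gs.2.
  have T_continuous gs : continuous (T gs) by exact: conf_act_continuous.
  have T_free gs y : T gs y = y -> forall y', T gs y' = y'.
    by rewrite /T => /(conf_act_fix act_free)[-> ->] y'; exact: conf_act1.
  apply: (@braid_projection_isomorphic _ _ _ _ _ _ _ _
    (@unordered_orbit_proj _ _ act n) (orbit_braid_group R x_free) idfun).
  + exact: unordered_orbit_proj_continuous.
  + by [].
  + move=> p y; apply/esym/unordered_orbit_proj_eq.
    exists (finfun (op_g (class_path p)), op_s (class_path p)); congr conf_act.
    by apply/funext => i; rewrite ffunE.
  + by move=> a _; exists (braid_class x_free a).
  + by move=> y /esym /unordered_orbit_proj_eq[[g s] ->]; exists g, s.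
  + move=> f; exact: (path_lift F_hausdorff
      (@unordered_orbit_proj_open _ _ act n)
      (@unordered_orbit_proj_surj _ _ act n) T_continuous
      (@unordered_orbit_proj_eq _ _ act n) T_free).
  + move=> a b; exact: (path_homotopic_lift F_hausdorff
      (@unordered_orbit_proj_continuous _ _ act n)
      (@unordered_orbit_proj_open _ _ act n)
      (@unordered_orbit_proj_surj _ _ act n)
      T_continuous (@unordered_orbit_proj_eq _ _ act n) T_free).
Qed.
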